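(* Let $a,c$ be nonzero complex numbers and let $\ell,m,n$ be nonnegative integers. Then $$ {}_4\phi_3\left[\begin{matrix}q^{-n},\,a,\,c,\,-q^{1+\ell-m-n}/(ac)\\ q^{1+\ell-n}/a,\,q^{1-m-n}/c,\,-ac\end{matrix};q,q\right] =\frac{(q^{1+\ell-n}/a^2,\,-q/a;q)_\ell}{(q^{1+\ell}/a^2,\,-q^{1-n}/a;q)_\ell}\, \frac{(-a,\,q^{m}c^2;q)_n}{(-ac,\,q^{m}c;q)_n}\sum_{i=0}^{\ell}\sum_{j=0}^{m}T_{i,j}, $$ where $$ T_{i,j}=(-1)^{i}q^{ni+(m+n-i)j-\binom{j}{2}}\,a^ic^{n-i}\,\frac{1-q^{2i-2\ell-1}a^2}{1-q^{-2\ell-1}a^2}\, \frac{(q^{-\ell},q^{-n},q^{-2\ell-1}a^2;q)_i}{(q,\,q^{n-2\ell}a^2,\,q^{-\ell}a^2;q)_i} $$ $$ \times\frac{(q^{-m},\,q^{i-n},\,q^{1+2\ell-n-i}/a^2,\,c,\,-c;q)_j}{(q,\,q^{1+\ell-n}/a,\,-q^{1+\ell-n}/a,\,q^{m}c^2,\,q^{j-1}c^2;q)_j}\, \frac{(q,\,q^{2+2\ell-2n}/(a^2c^2);q^2)_{(n-i-j)/2}}{(q^{2+2\ell-2n+2j}/a^2,\,q^{1+2j}c^2;q^2)_{(n-i-j)/2}}\,\chi(n-i-j). $$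
   Context: $q$ is a nonzero complex number. For complex $x$ and an integer $n\ge 0$, the $q$-shifted factorial is $(x;q)_0=1$, $(x;q)_n=\prod_{k=0}^{n-1}(1-xq^k)$, and $(x_1,\dots,x_r;q)_n=\prod_{s=1}^r (x_s;q)_n$ (likewise with base $q^2$ in place of $q$). The basic hypergeometric series is ${}_4\phi_3\left[\begin{matrix}a_0,a_1,a_2,a_3\\ b_1,b_2,b_3\end{matrix};q,z\right]=\sum_{k\ge0}\frac{(a_0,a_1,a_2,a_3;q)_k}{(q,b_1,b_2,b_3;q)_k}z^k$. Here one upper parameter is $q^{-n}$, so the series terminates and means the sum over $0\le k\le n$. Parameters are assumed to be such that no zero factor appears in a denominator of the displayed expressions. Put $\chi(k)=\{1+(-1)^k\}/2$. A term with $i+j>n$ contains the vanishing factor $(q^{-n};q)_i(q^{i-n};q)_j$ and is read as $0$; terms with $\chi(n-i-j)=0$ are also read as $0$. *)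

(* Defs.v *)
From mathcomp Require Import all_boot all_order all_algebra.
From mathcomp Require Export complex reals.

Set Implicit Arguments.
Unset Strict Implicit.
Unset Printing Implicit Defensive.

Import GRing.Theory.
Local Open Scope ring_scope.

Section QSeries.
Variable F : fieldType.

(* (x; q)_n *)
Definition qpoch (q x : F) (n : nat) : F := \prod_(k < n) (1 - x * q ^+ k).

(* (x_1, ..., x_r; q)_n *)
Definition qpochs (q : F) (xs : seq F) (n : nat) : F :=
  \prod_(x <- xs) qpoch q x n.

(* The 4phi3 series with upper parameters q^{-n}, a1, a2, a3; the parameter
   q^{-n} makes it terminate, so it is the sum over 0 <= k <= n. *)
Definition phi43 (q : F) (n : nat) (a1 a2 a3 b1 b2 b3 z : F) : F :=
  \sum_(0 <= k < n.+1)
    qpochs q [:: q ^ (- n%:Z); a1; a2; a3] k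
      / qpochs q [:: q; b1; b2; b3] k * z ^+ k.

Definition chi (k : nat) : F := (1 + (-1) ^+ k) / 2%:R.

(* The summand T_{i,j}, read as 0 when i + j > n.  Exponents of q are integers,
   those of a and c are naturals (i <= n in the first branch).  When n - i - j
   is odd the rounded half (n - i - j)./2 is immaterial since chi vanishes. *)
Definition Tterm (q a c : F) (l m n i j : nat) : F :=
  if (i + j <= n)%N then
    (-1) ^+ i
    * q ^ (n%:Z * i%:Z + (m%:Z + n%:Z - i%:Z) * j%:Z - 'C(j, 2)%:Z)
    * a ^+ i * c ^+ (n - i)
    * ((1 - q ^ (2 * i%:Z - 2 * l%:Z - 1) * a ^+ 2)
       / (1 - q ^ (- 2 * l%:Z - 1) * a ^+ 2))
    * (qpochs q [:: q ^ (- l%:Z); q ^ (- n%:Z);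
                    q ^ (- 2 * l%:Z - 1) * a ^+ 2] i
       / qpochs q [:: q; q ^ (n%:Z - 2 * l%:Z) * a ^+ 2;
                      q ^ (- l%:Z) * a ^+ 2] i)
    * (qpochs q [:: q ^ (- m%:Z); q ^ (i%:Z - n%:Z);
                    q ^ (1 + 2 * l%:Z - n%:Z - i%:Z) / a ^+ 2; c; - c] j
       / qpochs q [:: q; q ^ (1 + l%:Z - n%:Z) / a;
                      - q ^ (1 + l%:Z - n%:Z) / a;
                      q ^ m%:Z * c ^+ 2; q ^ (j%:Z - 1) * c ^+ 2] j)
    * (qpochs (q ^+ 2)
         [:: q; q ^ (2 + 2 * l%:Z - 2 * n%:Z) / (a ^+ 2 * c ^+ 2)]
         (n - i - j)./2
       / qpochs (q ^+ 2)
         [:: q ^ (2 + 2 * l%:Z - 2 * n%:Z + 2 * j%:Z) / a ^+ 2;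
             q ^ (1 + 2 * j%:Z) * c ^+ 2]
         (n - i - j)./2)
    * chi (n - i - j)
  else 0.

(* No zero factor in the denominators of T_{i,j}. *)
Definition Tterm_defined (q a c : F) (l m n i j : nat) : Prop :=
  [/\ 1 - q ^ (- 2 * l%:Z - 1) * a ^+ 2 != 0,
      qpochs q [:: q; q ^ (n%:Z - 2 * l%:Z) * a ^+ 2;
                      q ^ (- l%:Z) * a ^+ 2] i != 0,
      qpochs q [:: q; q ^ (1 + l%:Z - n%:Z) / a;
                      - q ^ (1 + l%:Z - n%:Z) / a;
                      q ^ m%:Z * c ^+ 2; q ^ (j%:Z - 1) * c ^+ 2] j != 0
    & qpochs (q ^+ 2)
         [:: q ^ (2 + 2 * l%:Z - 2 * n%:Z + 2 * j%:Z) / a ^+ 2;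
             q ^ (1 + 2 * j%:Z) * c ^+ 2]
         (n - i - j)./2 != 0].

End QSeries.

(* Main.v *)
Require Import Defs.
From mathcomp Require Import all_boot all_order all_algebra.
From mathcomp Require Import complex reals.
From mathcomp Require Import ring zify.

(** Reversing the factors with argument q^{1-n}/x turns the 4phi3 into a
    multiple of the convolution P(a, c; A, C; n) of the coefficients of
    2phi1(a, c; -ac; -z) and 2phi1(A, C; -AC; z), with A = a q^{-l} and
    C = c q^m.  A contiguity relation connecting (a, A, n) with (a/q, A, n) and
    (a, A q, n - 1) expands P, by induction on l, over the convolutions whose
    two first parameters are both A q^i.  As P is symmetric in (a, A) <->
    (c, C) and under reversal, the same expansion then equalizes the second
    parameters at c q^j.  The remaining diagonal convolutions vanish for odd n
    by antisymmetry and are products for even n by a recurrence n -> n + 2.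

    All this needs a^2, c^2 and a^2 c^2 not to be powers of q.  The general case
    is obtained by running the argument for a t, c t over the field of rational
    functions in t and specializing to t = 1. *)

Set Implicit Arguments.
Unset Strict Implicit.
Unset Printing Implicit Defensive.

Import GRing.Theory.
Local Open Scope ring_scope.

(** The intermediate formulas divide by shifted factorials such as (A^2;q)_n, not all of whose
    factors occur in the denominators of the statement. As the inverse in a field is total, with 0
    as inverse of 0, such formulas may fail at special parameters; hence the detour through generic
    ones. Only a and c are deformed. The base q stays a constant and may be a root of unity of order
    greater than n, so (q;q)_n != 0 is carried as a hypothesis of its own beside the genericity of a
    and c. One variable t suffices, since a^2, c^2 and a^2 c^2 acquire the factors t^2, t^2 and t^4.
    The closed forms (expansion coefficients, diagonal values) are verified rather than derived:
    each satisfies the recurrence of the quantity it describes, and the check is a rational identity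
    in which powers of q such as q^k and q^(n-k) are independent variables. *)

(** * Shifted factorials: splitting, bisection, reversal *)

Section Pochhammer.
Variable F : fieldType.
Implicit Types q x a c A C : F.

Lemma qpoch0 q x : qpoch q x 0 = 1.
Proof. by rewrite /qpoch big_ord0. Qed.

Lemma qpochS q x n : qpoch q x n.+1 = qpoch q x n * (1 - x * q ^+ n).
Proof. by rewrite /qpoch big_ord_recr. Qed.

Lemma qpochSl q x n : qpoch q x n.+1 = (1 - x) * qpoch q (x * q) n.
Proof.
rewrite /qpoch big_ord_recl /= expr0 mulr1; congr (_ * _).
by apply: eq_bigr => i _; rewrite /bump /= add1n exprS mulrA.
Qed.

Lemma qpochD q x m n :
  qpoch q x (m + n) = qpoch q x m * qpoch q (x * q ^+ m) n.
Proof.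
elim: n => [|n IHn]; first by rewrite addn0 qpoch0 mulr1.
by rewrite addnS !qpochS IHn exprD !mulrA.
Qed.

Lemma qpoch_sqr q x n :
  qpoch (q ^+ 2) (x ^+ 2) n = qpoch q x n * qpoch q (- x) n.
Proof.
rewrite /qpoch -big_split /=; apply: eq_bigr => i _.
rewrite -exprM mulnC exprM; ring.
Qed.

Lemma qpoch_bisect q x h :
  qpoch q x h.*2 = qpoch (q ^+ 2) x h * qpoch (q ^+ 2) (x * q) h.
Proof.
elim: h => [|h IHh]; first by rewrite !qpoch0 mulr1.
rewrite doubleS !qpochS IHh -exprM -mul2n (exprS q (2 * h)); ring.
Qed.

(** For e = 1 - n + s, the factor 1 - q^e/x is -q^e/x times the factor 1 - x q^(n-1-s) of (x;q)_n.
    The power of q is left as a product because quotients of two reversals cancel it. *)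
Lemma qpoch_rev q x k n : q != 0 -> x != 0 -> (k <= n)%N ->
  qpoch q (q ^ (1 - n%:Z) / x) k * qpoch q x (n - k)
    = qpoch q x n * (- x^-1) ^+ k * \prod_(s < k) (q ^ (1 - n%:Z) * q ^+ s).
Proof.
move=> q0 x0; elim: k => [|k IHk] lekn.
  by rewrite qpoch0 subn0 big_ord0 !expr0 !mulr1 mul1r.
rewrite qpochS big_ord_recr /= [_ ^+ k.+1]exprS.
have := IHk (ltnW lekn).
have -> : (n - k = (n - k.+1).+1)%N by rewrite -subSn.
rewrite qpochS => IH.
have E : q ^ (1 - n%:Z) * q ^+ k * q ^+ (n - k.+1) = 1.
  rewrite !exprnP -!expfzDr //.
  rewrite [X in q ^ X](_ : _ = 0) ?expr0z //.
  move: (subnKC lekn); set z := (n - k.+1)%N => <-.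
  by rewrite -addn1 !PoszD; ring.
have y0 : 1 - x * q ^+ (n - k.+1) = - x * q ^+ (n - k.+1) *
   (1 - q ^ (1 - n%:Z) / x * q ^+ k).
  transitivity (q ^ (1 - n%:Z) * q ^+ k * q ^+ (n - k.+1) - x * q ^+ (n - k.+1)); first by rewrite E.
  by field.
have w0 : q ^+ (n - k.+1) != 0 by rewrite expf_neq0.
move: IH; rewrite y0.
set u := qpoch _ _ k; set v := qpoch _ _ _; set r := (1 - _ / x * _).
set p := \prod_(i < k) _; set w := q ^+ (n - k.+1) in E w0 *.
set z := q ^ _ in E *; set y := q ^+ k in E *.
move=> IH.
have zy : z * y = w^-1 by apply: (mulIf w0); rewrite E mulVf.
rewrite zy.
transitivity ((u * (v * (- x * w * r))) * (- x^-1) * w^-1); first by field; rewrite x0 w0.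
by rewrite IH; ring.
Qed.

Lemma qpoch_shift q x m n :
  qpoch q x m * qpoch q (x * q ^+ m) n = qpoch q x n * qpoch q (x * q ^+ n) m.
Proof. by rewrite -!qpochD addnC. Qed.

End Pochhammer.

(** * Generic parameters, the convolution and its contiguity relation *)

Section Contiguity.
Variable F : fieldType.
Variable q : F.
Hypothesis q0 : q != 0.
Implicit Types x a c A C : F.

(** Genericity in a form stable under integer shifts: one hypothesis on x keeps the shifted
    factorials of every x q^k nonzero, and imposed on x^2 it covers both x and -x. *)
Definition nonqpow x := forall k : int, x * q ^ k != 1.

Lemma nonqpowM x (k : int) : nonqpow x -> nonqpow (x * q ^ k).
Proof. by move=> Hx j; rewrite -mulrA -expfzDr. Qed.

Lemma nonqpowMX x k : nonqpow x -> nonqpow (x * q ^+ k).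
Proof. by move=> Hx; rewrite exprnP; apply: nonqpowM. Qed.

Lemma nonqpowMl x : nonqpow x -> nonqpow (x * q).
Proof. by move/(nonqpowMX 1); rewrite expr1. Qed.

Lemma nonqpow_sqr x : nonqpow (x ^+ 2) -> nonqpow x.
Proof.
move=> Hx k; apply/eqP => E; have /eqP[] := Hx (k + k).
by rewrite expfzDr // expr2 mulrACA E mulr1.
Qed.

Lemma nonqpow_sqrN x : nonqpow (x ^+ 2) -> nonqpow (- x).
Proof. by move=> Hx; apply: nonqpow_sqr; rewrite sqrrN. Qed.

Lemma nonqpow_subX x k : nonqpow x -> 1 - x * q ^+ k != 0.
Proof. by move=> Hx; rewrite subr_eq0 eq_sym; apply: (Hx (Posz k)). Qed.

Lemma nonqpow_sub x : nonqpow x -> 1 - x != 0.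
Proof. by move=> /(nonqpow_subX 0); rewrite mulr1. Qed.

Lemma qpoch_neq0 x n : nonqpow x -> qpoch q x n != 0.
Proof. by move=> Hx; apply/prodf_neq0 => i _; apply: nonqpow_subX. Qed.

Lemma qpoch2_neq0 x n : nonqpow x -> qpoch (q ^+ 2) x n != 0.
Proof.
by move=> Hx; apply/prodf_neq0 => i _; rewrite -exprM; apply: nonqpow_subX.
Qed.

Lemma qfact_neq0W m n : (m <= n)%N -> qpoch q q n != 0 -> qpoch q q m != 0.
Proof. by move=> /subnKC <-; rewrite qpochD mulf_eq0 negb_or => /andP[]. Qed.

Lemma qfactS_neq0 k n : (k < n)%N -> qpoch q q n != 0 -> 1 - q ^+ k.+1 != 0.
Proof.
move=> kn /(qfact_neq0W kn); rewrite qpochS -exprS mulf_eq0 negb_or.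
by case/andP.
Qed.

(* The coefficient of z^k in 2phi1(a, c; -ac; q, z). *)
Definition phi21c a c k : F :=
  qpoch q a k * qpoch q c k / (qpoch q q k * qpoch q (- (a * c)) k).

Definition phi21conv a c A C n : F :=
  \sum_(k < n.+1) (-1) ^+ k * phi21c a c k * phi21c A C (n - k).

Lemma phi21cS a c k : qpoch q q k.+1 != 0 -> nonqpow (- (a * c)) ->
  phi21c a c k.+1 * ((1 - q ^+ k.+1) * (1 + a * c * q ^+ k))
   = phi21c a c k * ((1 - a * q ^+ k) * (1 - c * q ^+ k)).
Proof.
move=> qk Hac; have := qfactS_neq0 (ltnSn k) qk.
have := qfact_neq0W (leqnSn k) qk.
have := nonqpow_subX k Hac; have := qpoch_neq0 k Hac.
rewrite /phi21c !qpochS -exprS mulNr opprK => *.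
by field; apply/and4P.
Qed.

Lemma phi21c_shift a c k : nonqpow a -> nonqpow (- (a * c)) ->
  phi21c a c k * ((1 - a * q ^+ k) * (1 + a * c))
   = phi21c (a * q) c k * ((1 - a) * (1 + a * c * q ^+ k)).
Proof.
move=> Ha Hac; rewrite /phi21c.
have Ea := qpochS q a k; rewrite qpochSl in Ea.
have Eac := qpochS q (- (a * c)) k; rewrite qpochSl !mulNr !opprK in Eac.
have -> : - (a * q * c) = - (a * c * q) by ring.
have n1 := nonqpow_sub Ha; have n2 := nonqpow_sub Hac.
have n3 := nonqpow_subX k Hac; rewrite opprK in n2; rewrite mulNr opprK in n3.
have n4 := qpoch_neq0 k Hac.
have Hacq : qpoch q (- (a * c * q)) k != 0.
  by rewrite -mulNr; apply: qpoch_neq0; apply: nonqpowMl.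
have -> : qpoch q a k = (1 - a) * qpoch q (a * q) k / (1 - a * q ^+ k).
  by rewrite Ea mulfK //; apply: nonqpow_subX.
have -> : qpoch q (- (a * c)) k = (1 + a * c) * qpoch q (- (a * c * q)) k / (1 + a * c * q ^+ k).
  by rewrite Eac mulfK.
(* If (q;q)_k = 0, both coefficients are 0, because the inverse of 0 is 0. *)
case: (eqVneq (qpoch q q k) 0) => [-> | qk]; first by rewrite !mul0r invr0; ring.
field.
have n5 := nonqpow_subX k Ha.
by rewrite qk Hacq n2 n3 n5.
Qed.

Lemma phi21conv_rev a c A C n :
  phi21conv a c A C n = (-1) ^+ n * phi21conv A C a c n.
Proof.
rewrite /phi21conv mulr_sumr (reindex_inj rev_ord_inj) /=.
apply: eq_bigr => -[k /= kn] _; rewrite subSS ltnS in kn *.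
rewrite subKn //; move: (phi21c _ _ _) (phi21c _ _ _) => u v.
rewrite !mulrA -exprD -(signr_odd _ (n - k)) -(signr_odd _ (n + k)).
by rewrite oddB // oddD mulrAC.
Qed.

Lemma phi21c_sym a c k : phi21c a c k = phi21c c a k.
Proof. by rewrite /phi21c [a * c]mulrC [qpoch q a k * _]mulrC. Qed.

Lemma phi21conv_sym a c A C n : phi21conv a c A C n = phi21conv c a C A n.
Proof. by apply: eq_bigr => k _; rewrite (phi21c_sym a) (phi21c_sym A). Qed.

Lemma phi21conv_contiguous a c A C n : qpoch q q n.+1 != 0 ->
  nonqpow a -> nonqpow (- (a * c)) -> nonqpow C -> nonqpow A ->
  nonqpow (- (A * C)) ->
  (1 - a * A) * (1 + a * c * q ^+ n.+1) * phi21conv (a * q) c A C n.+1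
  = (1 - a * A * q ^+ n.+1) * (1 + a * c) * phi21conv a c A C n.+1
    - a * (1 - A ^+ 2) * (1 - c * C * q ^+ n) / (1 + A * C)
      * phi21conv (a * q) c (A * q) C n.
Proof.
move=> qn Ha Hac HC HA HAC.
have n1 := nonqpow_sub HA; have n2 := nonqpow_sub HAC.
rewrite opprK in n2.
have nC k : 1 - C * q ^+ k / q != 0.
  rewrite exprnP -mulrA -[q^-1](exprN1 q) -expfzDr //.
  by rewrite subr_eq0 eq_sym; apply: HC.
pose f k := (-1) ^+ k * phi21c (a * q) c k * phi21c A C (n.+1 - k).
(* The combination of summands is the telescoping difference h k - h k.-1. *)
pose h k := a * (-1) ^+ k * phi21c (a * q) c k * (1 - c * q ^+ k)
              * phi21c A C (n - k) * (1 - A * q ^+ (n - k)).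
(* [e1 k] and [e2 k] are [h k] and [h k.-1] as rational multiples of [f k]. Unlike [h], whose
   truncated subtractions go wrong at the ends, they vanish there: [e1] at n.+1 and [e2] at 0, each
   through a factor 1 - q^0. *)
pose e1 k := a * f k * (1 - c * q ^+ k) * (1 - q ^+ (n.+1 - k))
   * (1 + A * C * q ^+ (n.+1 - k) / q) / (1 - C * q ^+ (n.+1 - k) / q).
pose e2 k := - a * f k * (1 - q ^+ k) * (1 + a * c * q ^+ k) / (1 - a * q ^+ k)
   * (1 - A * q ^+ (n.+1 - k)).
(* The summand of the order-n convolution as a multiple of [f k]; it is 0 at k = n.+1, so all three
   sums can run over k < n.+2. *)
pose g k := (1 + A * C) / (1 - A) * f k * (1 - q ^+ (n.+1 - k)) / (1 - C * q ^+ (n.+1 - k) / q).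
have stepA k : (k <= n)%N -> 
  phi21c A C (n.+1 - k) * ((1 - q ^+ (n.+1 - k)) * (1 + A * C * q ^+ (n.+1 - k) / q))
   = phi21c A C (n - k) * ((1 - A * q ^+ (n - k)) * (1 - C * q ^+ (n.+1 - k) / q)).
  move=> kn; rewrite subSn //.
  have Hz z : z * q ^+ (n - k).+1 / q = z * q ^+ (n - k).
    by rewrite exprSr mulrA mulfK.
  rewrite !Hz.
  apply: phi21cS => //; apply: qfact_neq0W qn; exact: leq_subr.
have E1 k : (k <= n)%N -> e1 k = h k.
  move=> kn; have Hs := stepA k kn; have n3 := nC (n.+1 - k)%N.
  rewrite /e1 /h /f; move: Hs n3.
  move: (phi21c A C (n.+1 - k)) (phi21c A C (n - k)) (phi21c (a * q) c k) => u v w.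
  move: (q ^+ (n.+1 - k)) (q ^+ (n - k)) ((-1) ^+ k) => y y' s Hs n3.
  apply: (mulIf n3); rewrite mulfVK //.
  transitivity (a * s * w * (1 - c * q ^+ k) * (u * ((1 - y) * (1 + A * C * y / q)))); first by ring.
  by rewrite Hs; ring.
have E2 k : (k <= n)%N -> e2 k.+1 = h k.
  move=> kn; have qk : qpoch q q k.+1 != 0 by apply: qfact_neq0W qn.
  have Hs : phi21c (a * q) c k.+1 * ((1 - q ^+ k.+1) * (1 + a * c * q ^+ k.+1))
      = phi21c (a * q) c k * ((1 - a * q ^+ k.+1) * (1 - c * q ^+ k)).
    have Haqc : nonqpow (- (a * q * c)).
      rewrite (_ : - (a * q * c) = - (a * c) * q); [exact: nonqpowMl | ring].
    have := phi21cS qk Haqc; rewrite (exprS q k).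
    rewrite (_ : a * q * c * q ^+ k = a * c * (q * q ^+ k)); last by ring.
    by rewrite [a * (q * _)]mulrA.
  have n3 := nonqpow_subX k.+1 Ha.
  rewrite /e2 /h /f subSS exprS; move: Hs n3.
  move: (phi21c A C _) (phi21c (a * q) c k.+1) (phi21c (a * q) c k) => u v w.
  rewrite exprS; move: (q ^+ (n - k)) (q ^+ k) ((-1) ^+ k) => y x s Hs n3.
  apply: (mulIf n3); rewrite mulrAC mulfVK //.
  transitivity (a * s * (1 - A * y) * u * (v * ((1 - q * x) * (1 + a * c * (q * x))))); first by ring.
  by rewrite Hs; ring.
have G1 k : (k <= n)%N -> g k = (-1) ^+ k * phi21c (a * q) c k * phi21c (A * q) C (n - k).
  move=> kn; have Hs := stepA k kn; have n3 := nC (n.+1 - k)%N.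
  have Hs2 := phi21c_shift (n - k) HA HAC.
  rewrite /g /f; move: Hs Hs2 n3.
  rewrite subSn // exprSr.
  have Hz z : z * (q ^+ (n - k) * q) / q = z * q ^+ (n - k).
    by rewrite mulrA mulfK.
  rewrite !Hz.
  move: (nonqpow_subX (n - k) HAC); rewrite mulNr opprK.
  move: (phi21c A C (n - k).+1) (phi21c A C (n - k)) (phi21c (A * q) C (n - k)) => u v w.
  move: (phi21c _ _ _) => t.
  move: (q ^+ (n - k)) ((-1) ^+ k) => y s n4 Hs Hs2 n3.
  apply: (mulIf n4); apply: (mulIf n3); apply: (mulIf n1).
  transitivity ((1 + A * C) * s * t * (u * ((1 - y * q) * (1 + A * C * y)))).
    by field; rewrite n1 n3.
  rewrite Hs.
  transitivity (s * t * (1 - C * y) * (v * ((1 - A * y) * (1 + A * C)))); first by ring.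
  by rewrite Hs2; ring.
have F1 k : phi21c a c k * (1 - a * q ^+ k) * (1 + a * c)
   = phi21c (a * q) c k * ((1 - a) * (1 + a * c * q ^+ k)).
  by rewrite -phi21c_shift // mulrA.
have key k : (k < n.+2)%N ->
  (1 - a * A) * (1 + a * c * q ^+ n.+1) * f k
  - (1 - a * A * q ^+ n.+1) * (1 + a * c) * ((-1) ^+ k * phi21c a c k * phi21c A C (n.+1 - k))
  + a * (1 - A ^+ 2) * (1 - c * C * q ^+ n) / (1 + A * C) * g k
  = e1 k - e2 k.
  move=> kn.
  rewrite /e1 /e2 /g -[X in _ - X + _]mulrA.
  have -> : (1 + a * c) * ((-1) ^+ k * phi21c a c k * phi21c A C (n.+1 - k))
     = (1 - a) * (1 + a * c * q ^+ k) / (1 - a * q ^+ k) * f k.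
    have n3 := nonqpow_subX k Ha.
    apply: (mulIf n3); rewrite /f; move: (F1 k) n3.
    move: (phi21c A C _) (phi21c a c k) (phi21c (a * q) c k) => u v w.
    move: (q ^+ k) ((-1) ^+ k) => x s Hs n3.
    transitivity (s * u * (v * (1 - a * x) * (1 + a * c))); first by ring.
    by rewrite Hs; field.
  (* With x = q^k and y = q^(n.+1-k), replacing q^n.+1 by x y leaves a rational identity in
     independent x and y. *)
  have -> : q ^+ n.+1 = q ^+ k * q ^+ (n.+1 - k) by rewrite -exprD subnKC.
  have -> : q ^+ n = q ^+ k * q ^+ (n.+1 - k) / q.
    by rewrite -exprD subnKC // exprSr mulfK.
  have n3 := nonqpow_subX k Ha; have n4 := nC (n.+1 - k)%N.
  move: (f k) (q ^+ (n.+1 - k)) (q ^+ k) n3 n4 => u y x n3 n4.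
  have n5 : q - C * y != 0 by rewrite (_ : q - C * y = (1 - C * y / q) * q) ?mulf_neq0 //; field.
  by field; rewrite n1 n2 n3 q0 n5.
have esum : \sum_(k < n.+2) e1 k = \sum_(k < n.+2) e2 k.
  rewrite big_ord_recr [RHS]big_ord_recl /=.
  have -> : e1 n.+1 = 0 by rewrite /e1 subnn; ring.
  have -> : e2 0%N = 0 by rewrite /e2; ring.
  rewrite addr0 add0r; apply: eq_bigr => -[k kn] _ /=.
  by rewrite /bump /= add1n E1 // E2.
have gsum : phi21conv (a * q) c (A * q) C n = \sum_(k < n.+2) g k.
  rewrite [RHS]big_ord_recr /=.
  have -> : g n.+1 = 0 by rewrite /g subnn; ring.
  by rewrite addr0; apply: eq_bigr => -[k kn] _; rewrite G1.
apply/eqP; rewrite -subr_eq0 opprB addrA gsum /phi21conv.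
rewrite 3!mulr_sumr -sumrN -!big_split /=.
apply/eqP; transitivity (\sum_(k < n.+2) (e1 k - e2 k)).
  by apply: eq_bigr => -[k kn] _; rewrite -key //= addrAC.
by rewrite sumrB esum subrr.
Qed.

End Contiguity.

(** * Expansion over convolutions with equal first parameters *)

Section Expansion.
Variable F : fieldType.
Variable q : F.
Hypothesis q0 : q != 0.
Implicit Types x a c A C : F.
Local Notation nonqpow := (nonqpow q).
Local Notation phi21c := (phi21c q).
Local Notation phi21conv := (phi21conv q).

(* For a = A q^l the product over s equals a^i (q^{-l})_i, so the coefficients
   with i > l vanish. *)
Definition expand_coef a A c C n i : F :=
  qpoch q (a * A) n * qpoch q (- (A * c)) n
    / (qpoch q (A ^+ 2) n * qpoch q (- (a * c)) n)
  * (qpoch (q ^+ 2) (A ^+ 2) i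
     * ((1 - A ^+ 2 * q ^+ (2 * i) / q) / (1 - A ^+ 2 / q))
     * (\prod_(s < i) (a - A * q ^+ s)) * qpoch q (A ^+ 2 / q) i
     / (qpoch q q i * qpoch q (A ^+ 2 * q ^+ n) i * qpoch q (a * A) i))
  * q ^+ 'C(i, 2) * qpoch q (c * C * q ^+ (n - i)) i
  / (qpoch q (- (A * c)) i * qpoch q (- (A * C)) i).

Lemma nonqpowMV x : nonqpow x -> nonqpow (x / q).
Proof. by rewrite -exprN1; apply: nonqpowM. Qed.

Lemma expand_coef0 a A c C n : nonqpow (A ^+ 2) ->
  expand_coef a A c C n 0 =
  qpoch q (a * A) n * qpoch q (- (A * c)) n
    / (qpoch q (A ^+ 2) n * qpoch q (- (a * c)) n).
Proof.
move=> HA; rewrite /expand_coef !qpoch0 big_ord0 muln0 bin0n !expr0 !mulr1.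
by rewrite divff ?(nonqpow_sub (nonqpowMV HA)) // !mulr1 invr1 !mulr1.
Qed.

(** The contiguity relation read off coefficientwise. The convolution of order n is based at A q,
    and (A q) q^i = A q^(i+1), so its index i contributes to index i.+1. *)
Lemma expand_coef_rec a A c C n i : (i <= n)%N -> qpoch q q n.+1 != 0 ->
  nonqpow (A ^+ 2) -> nonqpow (a * A) -> nonqpow (- (a * c)) ->
  nonqpow (- (A * c)) -> nonqpow (- (A * C)) ->
  (1 - a * A) * (1 + a * c * q ^+ n.+1) * expand_coef (a * q) A c C n.+1 i.+1
  = (1 - a * A * q ^+ n.+1) * (1 + a * c) * expand_coef a A c C n.+1 i.+1
    - a * (1 - A ^+ 2) * (1 - c * C * q ^+ n) / (1 + A * C)
      * expand_coef (a * q) (A * q) c C n i.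
Proof.
move=> ilen qn HA HaA Hac HAc HAC.
have nX := nonqpow_subX n.+1 HaA.
have nX1 := nonqpow_subX 1 HaA; rewrite expr1 in nX1.
have nX0 := nonqpow_sub HaA.
have nac := nonqpow_sub Hac; rewrite opprK in nac.
have nacn := nonqpow_subX n.+1 Hac; rewrite mulNr opprK in nacn.
have nAc := nonqpow_sub HAc; rewrite opprK in nAc.
have nAC := nonqpow_sub HAC; rewrite opprK in nAC.
have nA := nonqpow_sub HA.
have nA1 := nonqpow_subX 1 HA; rewrite expr1 in nA1.
have nAi := nonqpow_subX i HA.
have nAV := nonqpow_sub (nonqpowMV HA).
have nX2 := nonqpow_subX i.+1 HaA.
(* Every shifted factorial in the three coefficients is expressed by a common one and a few linear
   factors; once the common ones are abstracted, [field] decides the rest. *)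
pose X := qpoch q (a * A * q ^+ 2) n.
have eX1 : qpoch q (a * q * A) n.+1 = (1 - a * A * q) * X.
  rewrite qpochSl /X (_ : a * q * A = a * A * q); last by ring.
  by congr (_ * qpoch q _ _); ring.
have eX2 : qpoch q (a * A) n.+1
     = (1 - a * A) * (1 - a * A * q) * X / (1 - a * A * q ^+ n.+1).
  apply: (mulIf nX); rewrite mulfVK // -qpochS qpochSl -[RHS]mulrA -eX1.
  by congr (_ * qpoch q _ _); ring.
have eX3 : qpoch q (a * q * (A * q)) n = X by congr (qpoch q _ _); ring.
pose V := qpoch q (a * A * q ^+ 2) i.
have nV : V != 0 by apply: qpoch_neq0; apply: nonqpowMX.
have eV1 : qpoch q (a * q * A) i.+1 = (1 - a * A * q) * V.
  rewrite qpochSl /V (_ : a * q * A = a * A * q); last by ring.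
  by congr (_ * qpoch q _ _); ring.
have eV2 : qpoch q (a * A) i.+1
     = (1 - a * A) * (1 - a * A * q) * V / (1 - a * A * q ^+ i.+1).
  apply: (mulIf nX2); rewrite mulfVK // -qpochS qpochSl -[RHS]mulrA -eV1.
  by congr (_ * qpoch q _ _); ring.
have eV3 : qpoch q (a * q * (A * q)) i = V by congr (qpoch q _ _); ring.
pose Z := qpoch q (- (a * q * c)) n.
have eZ : - (a * q * c) = - (a * c) * q by ring.
have nZ : Z != 0 by rewrite /Z eZ; apply: qpoch_neq0; apply: nonqpowMl.
have eZ1 : qpoch q (- (a * q * c)) n.+1 = Z * (1 + a * c * q ^+ n.+1).
  by rewrite qpochS -/Z exprS; congr (_ * _); ring.
have eZ2 : qpoch q (- (a * c)) n.+1 = (1 + a * c) * Z.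
  by rewrite qpochSl opprK /Z eZ.
pose W := qpoch q (- (A * q * c)) n.
have eW : - (A * q * c) = - (A * c) * q by ring.
have eW1 : qpoch q (- (A * c)) n.+1 = (1 + A * c) * W.
  by rewrite qpochSl opprK /W eW.
pose D1 := qpoch q (A ^+ 2) n.+1.
have nD1 : D1 != 0 by apply: qpoch_neq0.
pose D2 := qpoch q ((A * q) ^+ 2) n.
have nD2 : D2 != 0.
  by apply: qpoch_neq0; rewrite exprMn; apply: nonqpowMX.
pose D3 := qpoch q ((A * q) ^+ 2 * q ^+ n) i.
have nD3 : D3 != 0.
  by apply: qpoch_neq0; rewrite exprMn; do 2! apply: nonqpowMX => //.
have eD : qpoch q (A ^+ 2 * q ^+ n.+1) i.+1
    = (1 - A ^+ 2) * (1 - A ^+ 2 * q) * (D2 * D3) / D1.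
  apply: (mulfI nD1); rewrite mulrC [RHS]mulrC mulfVK // mulrC -qpochD.
  rewrite addSn addnS qpochSl qpochSl /D2 /D3 -qpochD mulrA.
  by congr (_ * qpoch q _ _); ring.
pose Q2 := qpoch (q ^+ 2) ((A * q) ^+ 2) i.
have eQ2 : qpoch (q ^+ 2) (A ^+ 2) i.+1 = (1 - A ^+ 2) * Q2.
  by rewrite qpochSl /Q2 exprMn.
pose S := qpoch q ((A * q) ^+ 2 / q) i.
have ASq : (A * q) ^+ 2 / q = A ^+ 2 * q by field.
have eS : qpoch q (A ^+ 2 / q) i.+1
   = (1 - A ^+ 2 / q) * ((1 - A ^+ 2) * S / (1 - A ^+ 2 * q ^+ i)).
  rewrite qpochSl mulfVK //; congr (_ * _); apply: (mulIf nAi).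
  by rewrite mulfVK // -qpochS qpochSl /S ASq.
have eq2 : A ^+ 2 * q ^+ (2 * i.+1) / q = A ^+ 2 * q ^+ (2 * i) * q.
  by rewrite mulnS exprD; field.
have eq2' : (A * q) ^+ 2 * q ^+ (2 * i) / q = A ^+ 2 * q ^+ (2 * i) * q.
  by field.
have qi1 : qpoch q q i.+1 = qpoch q q i * (1 - q ^+ i.+1).
  by rewrite qpochS -exprS.
have nqi : qpoch q q i != 0 by apply: qfact_neq0W qn; apply: leqW.
have nqi1 : 1 - q ^+ i.+1 != 0 by apply: qfactS_neq0 qn.
have eC : qpoch q (c * C * q ^+ (n.+1 - i.+1)) i.+1
   = qpoch q (c * C * q ^+ (n - i)) i * (1 - c * C * q ^+ n).
  by rewrite subSS qpochS; congr (_ * (1 - _)); rewrite -mulrA -exprD subnK.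
have eb : q ^+ 'C(i.+1, 2) = q ^+ 'C(i, 2) * q ^+ i by rewrite binS bin1 exprD.
pose U1 := qpoch q (- (A * q * c)) i; pose U2 := qpoch q (- (A * q * C)) i.
have nU1 : U1 != 0 by rewrite /U1 eW; apply: qpoch_neq0; apply: nonqpowMl.
have eW' : - (A * q * C) = - (A * C) * q by ring.
have nU2 : U2 != 0 by rewrite /U2 eW'; apply: qpoch_neq0; apply: nonqpowMl.
have eU1 : qpoch q (- (A * c)) i.+1 = (1 + A * c) * U1.
  by rewrite qpochSl opprK /U1 eW.
have eU2 : qpoch q (- (A * C)) i.+1 = (1 + A * C) * U2.
  by rewrite qpochSl opprK /U2 eW'.
pose w := \prod_(s < i) (a * q - A * q * q ^+ s).
have ew1 : \prod_(s < i.+1) (a * q - A * q ^+ s) = (a * q - A) * w.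
  rewrite big_ord_recl expr0 mulr1; congr (_ * _); apply: eq_bigr => s _.
  by rewrite lift0 exprS mulrA.
have nqi0 : q ^+ i != 0 by rewrite expf_neq0.
have ew2 : \prod_(s < i.+1) (a - A * q ^+ s)
     = (a - A * q ^+ i) * w / q ^+ i.
  apply: (mulIf nqi0); rewrite mulfVK // big_ord_recr /= mulrAC mulrC.
  congr (_ * _); rewrite /w -[X in q ^+ X](card_ord i) -prodr_const -big_split /=.
  by apply: eq_bigr => s _; ring.
rewrite /expand_coef eX1 eX2 eX3 eV1 eV2 eV3 eZ1 eZ2 eW1 eD -/D1 -/D2 -/D3 -/Z -/W eQ2 -/Q2.
rewrite eS ASq -/S eq2 eq2' qi1 eC eb eU1 eU2 -/U1 -/U2 ew1 ew2 -/w.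
rewrite -ASq -/S.
clearbody X V Z W D1 D2 D3 Q2 S U1 U2 w.
move: (qpoch q q i) (qpoch q _ i) (q ^+ 'C(i, 2)) (q ^+ (2 * i)) nqi => t1 t2 t3 t4 nqi.
clear ew1 ew2 eU1 eU2 eC eb qi1 eq2 eq2' eS eQ2 eD eW1 eW eW' eZ1 eZ2 eZ eV1 eV2 eV3 eX1 eX2 eX3 ASq.
rewrite !(exprS q) in nX nacn nX2 nqi1 *.
move: (q ^+ n) (q ^+ i) nX nacn nX2 nqi1 nqi0 nAi => y x nX nacn nX2 nqi1 nqi0 nAi.
have nAV' : q - A ^+ 2 != 0.
  by rewrite (_ : q - A ^+ 2 = (1 - A ^+ 2 / q) * q) ?mulf_neq0 //; field.
field.
by rewrite nU2 nU1 nV nD3 nqi q0 nA1 nZ nD2 nAC nAc nX2 nD1 nX1 nX0 nA nqi1 nAi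
  nqi0 nAV' nac nX nacn.
Qed.

Lemma phi21conv0 a c A C : phi21conv a c A C 0 = 1.
Proof.
rewrite /phi21conv big_ord1 /phi21c !qpoch0 expr0 ?subn0 !mulr1 divff ?oner_neq0 //.
by rewrite !mulr1.
Qed.

Lemma phi21conv_expand l A c C n : qpoch q q n != 0 ->
  nonqpow (A ^+ 2) -> nonqpow (- (A * c)) -> nonqpow (- (A * C)) ->
  nonqpow C ->
  phi21conv (A * q ^+ l) c A C n
  = \sum_(i < n.+1) expand_coef (A * q ^+ l) A c C n i
      * phi21conv (A * q ^+ i) c (A * q ^+ i) C (n - i).
Proof.
elim: l A n => [|l IHl] A n qn HA HAc HAC HC.
  rewrite expr0 mulr1 big_ord_recl big1 ?addr0 => [|i _]; last first.
    rewrite /expand_coef lift0 big_ord_recl expr0 mulr1 subrr.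
    by rewrite !(mul0r, mulr0).
  rewrite expand_coef0 //= subn0 expr0 mulr1 -expr2 divff ?mul1r //.
  by rewrite mulf_neq0 // qpoch_neq0.
case: n qn => [|n] qn.
  rewrite big_ord1 expand_coef0 // !qpoch0 !mulr1 divr1 mul1r.
  by rewrite !phi21conv0.
have HaA : nonqpow (A * q ^+ l * A) by rewrite mulrAC -expr2; apply: nonqpowMX.
have HA1 : nonqpow A by apply: nonqpow_sqr.
have Hac : nonqpow (- (A * q ^+ l * c)).
  by rewrite mulrAC -mulNr; apply: nonqpowMX.
have Ha : nonqpow (A * q ^+ l) by apply: nonqpowMX.
have := phi21conv_contiguous q0 qn Ha Hac HC HA1 HAC.
rewrite IHl // (exprSr q l) (mulrA A (q ^+ l) q).
(* The induction hypothesis at A q: there (A q) q^l = A q^(l+1) and (A q) q^i = A q^(i+1), so this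
   expansion enters with its index raised by one. *)
have -> : phi21conv (A * q ^+ l * q) c (A * q) C n
  = \sum_(i < n.+1) expand_coef (A * q ^+ l * q) (A * q) c C n i
      * phi21conv (A * q ^+ i.+1) c (A * q ^+ i.+1) C (n - i).
  have := IHl (A * q) n; rewrite (mulrAC A q (q ^+ l)) => ->.
  - by apply: eq_bigr => i _; rewrite (mulrAC A q (q ^+ i)) exprSr mulrA.
  - exact: qfact_neq0W qn.
  - by rewrite exprMn; apply: nonqpowMX.
  - by rewrite mulrAC -mulNr; apply: nonqpowMl.
  - by rewrite mulrAC -mulNr; apply: nonqpowMl.
  - exact: HC.
move=> E.
set k := (1 - A * q ^+ l * A) * (1 + A * q ^+ l * c * q ^+ n.+1) in E *.
have k0 : k != 0.
  apply: mulf_neq0; first exact: nonqpow_sub HaA.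
  by have := nonqpow_subX n.+1 Hac; rewrite mulNr opprK.
apply: (mulfI k0); rewrite E.
set X := (1 - A * q ^+ l * A * q ^+ n.+1) * (1 + A * q ^+ l * c) in E *.
(* The order-n expansion contributes only to positive indices, so the terms of index 0 must agree by
   themselves. *)
rewrite big_ord_recl [in RHS]big_ord_recl (mulrDr X) (mulrDr k) -addrA.
congr (_ + _).
  rewrite [X * _]mulrA [k * _]mulrA; congr (_ * _).
  rewrite !expand_coef0 // /k /X.
  have Ea := qpochS q (A * q ^+ l * A) n.+1; rewrite qpochSl in Ea.
  have Eac := qpochS q (- (A * q ^+ l * c)) n.+1; rewrite qpochSl in Eac.
  have nAc : qpoch q (- (A * q ^+ l * c)) n.+1 != 0 by apply: qpoch_neq0.
  have nAc' : qpoch q (- (A * q ^+ l * q * c)) n.+1 != 0.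
    apply: qpoch_neq0; rewrite (mulrAC _ q c) -mulNr; exact: nonqpowMl.
  rewrite (_ : - (A * q ^+ l * c) * q = - (A * q ^+ l * q * c)) in Eac; last by ring.
  rewrite (_ : A * q ^+ l * A * q = A * q ^+ l * q * A) in Ea; last by ring.
  rewrite opprK mulNr opprK in Eac.
  have nA2 : qpoch q (A ^+ 2) n.+1 != 0 by apply: qpoch_neq0.
  move: Ea Eac nAc nAc' nA2.
  move: (qpoch q (A * q ^+ l * A) n.+1) (qpoch q (A * q ^+ l * q * A) n.+1)
    (qpoch q (- (A * q ^+ l * c)) n.+1) (qpoch q (- (A * q ^+ l * q * c)) n.+1)
    (qpoch q (A ^+ 2) n.+1) (qpoch q (- (A * c)) n.+1) => u v w t x y Eu Ew w0 t0 x0.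
  transitivity ((u * (1 - A * q ^+ l * A * q ^+ n.+1)) * y * (1 + A * q ^+ l * c) / (x * w)); first by ring.
  transitivity (((1 - A * q ^+ l * A) * v) * y * (1 + A * q ^+ l * c * q ^+ n.+1) / (x * t)); last by ring.
  rewrite -Eu; move: Ew; set z1 := 1 + _; set z2 := 1 + _ => Ew.
  have -> : z1 = w * z2 / t by rewrite -Ew mulfK.
  by field; rewrite w0 t0 x0.
rewrite !mulr_sumr -sumrN -big_split /=; apply: eq_bigr => i _.
have -> : bump 0 i = i.+1 by []; rewrite subSS [in RHS]mulrA /k expand_coef_rec //; last by rewrite -ltnS.
by rewrite [in RHS]mulrBl !mulrA.
Qed.
End Expansion.

(** * Evaluation of the diagonal convolutions *)

Section Diagonal.
Variable F : fieldType.
Variable q : F.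
Hypothesis q0 : q != 0.
Implicit Types x a c A C : F.
Local Notation nonqpow := (nonqpow q).
Local Notation phi21c := (phi21c q).
Local Notation phi21conv := (phi21conv q).

Lemma phi21conv_odd a c n : (2%:R != 0 :> F) -> odd n -> phi21conv a c a c n = 0.
Proof.
move=> two on; have := phi21conv_rev q a c a c n.
rewrite -signr_odd on expr1 mulN1r => /eqP; rewrite -addr_eq0 -mulr2n -mulr_natl.
by rewrite mulf_eq0 (negPf two) => /eqP.
Qed.

Lemma phi21conv_rec a c n : qpoch q q n.+2 != 0 -> nonqpow (- (a * c)) ->
  nonqpow a -> nonqpow c ->
  (1 - q ^+ n.+2) * (1 - (a * c) ^+ 2 * q ^+ n)
   * (1 + a * c * q ^+ n) * (1 + a * c * q ^+ n.+1) * phi21conv a c a c n.+2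
  = (1 - a ^+ 2 * q ^+ n) * (1 - c ^+ 2 * q ^+ n)
   * (1 - a * c * q ^+ n) * (1 - a * c * q ^+ n.+1) * phi21conv a c a c n.
Proof.
move=> qn Hac Ha Hc.
pose p := a * c; pose Q := q ^+ n.
pose g1 := p * Q / q * ((q - p) * (1 + p * Q) - (a + c) * (1 - p * q * Q)).
pose g0 := (1 - p ^+ 2 * Q) * (1 + p * Q) * (1 - a * q * Q) * (1 - c * q * Q)
   - g1 * (q + q ^+ 2 * Q).
(* The summands of both sides combine into h k - h k.-1; the coefficients g0 and
   g1 of the certificate are fixed by evaluating id1 at the zeros x = 1 and
   x = - q / p of D. *)
pose g (x : F) : F := g0 + g1 * (x + q ^+ 3 * Q / x).
pose u := phi21c a c.
pose h k : F := (-1) ^+ k * u k * u (n.+1 - k)%N * g (q ^+ k.+1).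
(* At x = q^k.+1 the ratio u k.+1 / u k is N x / D x. The zero of D at x = 1 removes all boundary
   terms below. *)
pose D (x : F) : F := (1 - x) * (1 + p * x / q).
pose N (x : F) : F := (1 - a * x / q) * (1 - c * x / q).
pose al := (1 - q ^+ n.+2) * (1 - p ^+ 2 * Q) * (1 + p * Q) * (1 + p * q ^+ n.+1).
pose be := (1 - a ^+ 2 * Q) * (1 - c ^+ 2 * Q) * (1 - p * Q) * (1 - p * q ^+ n.+1).
(* To be used at x = q^k, y = q^(n.+2-k). Under the constraint g x = g0 + g1 (x + q y) and g (q x) =
   g0 + g1 (q x + y), so both sides are symmetric in x and y, reflecting the reversal k -> n.+2 -
   k. *)
have id1 x y : x != 0 -> y != 0 -> x * y = q ^+ 2 * Q ->
  al * (N x * N y) + be * (D x * D y)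
   = g x * (N y * D x) + g (q * x) * (N x * D y).
  move=> x0 y0 xy.
  rewrite /al /be /N /D /g /g0 /g1 !exprS -/Q /p.
  have -> : Q = x * y / q ^+ 2 by rewrite xy; field.
  by clear -q0 x0; field; rewrite q0 x0.
have qX0 k : q ^+ k != 0 by rewrite expf_neq0.
have nN k : N (q ^+ k) != 0.
  by rewrite /N exprnP -!mulrA -exprN1 -expfzDr // mulf_neq0 // subr_eq0 eq_sym ?Ha ?Hc.
have us k : (k <= n.+1)%N -> u k.+1 * D (q ^+ k.+1) = u k * N (q ^+ k.+1).
  move=> kn; have Hz z : z * q ^+ k.+1 / q = z * q ^+ k.
    by rewrite exprSr mulrA mulfK.
  by rewrite /D /N !Hz; apply: phi21cS => //; apply: qfact_neq0W qn.
pose f k : F := (-1) ^+ k * u k * u (n.+2 - k)%N.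
pose e1 k := f k * (g (q * q ^+ k) * (D (q ^+ (n.+2 - k)) / N (q ^+ (n.+2 - k)))).
pose e2 k := - f k * (g (q ^+ k) * (D (q ^+ k) / N (q ^+ k))).
(* Minus the order-n summand of index k.-1, as a multiple of [f k]; it is 0 at both ends k = 0 and k
   = n.+2. *)
pose e3 k := f k * (D (q ^+ k) / N (q ^+ k) * (D (q ^+ (n.+2 - k)) / N (q ^+ (n.+2 - k)))).
have D1 : D 1 = 0 by rewrite /D subrr mul0r.
have uD k : (k <= n.+1)%N -> u k.+1 * (D (q ^+ k.+1) / N (q ^+ k.+1)) = u k.
  by move=> kn; rewrite mulrA us // mulfK.
have E1 k : (k <= n.+1)%N -> e1 k = h k.
  move=> kn; rewrite /e1 /f /h subSn // -exprS.
  rewrite -(uD (n.+1 - k)%N) ?leq_subr //; ring.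
have E2 k : (k <= n.+1)%N -> e2 k.+1 = h k.
  move=> kn; rewrite /e2 /f /h subSS (exprS (-1)) -(uD k) //; ring.
have E3 k : (k <= n)%N -> e3 k.+1 = - ((-1) ^+ k * u k * u (n - k)%N).
  move=> kn; rewrite /e3 /f subSS subSn // (exprS (-1)) -(uD k) ?(leqW kn) //.
  rewrite -(uD (n - k)%N); last by apply: leq_trans (leq_subr _ _) _.
  ring.
have key k : (k < n.+3)%N -> al * f k + be * e3 k = e1 k - e2 k.
  move=> kn; rewrite /e1 /e2 /e3.
  have := id1 (q ^+ k) (q ^+ (n.+2 - k)) (qX0 _) (qX0 _).
  have -> : q ^+ k * q ^+ (n.+2 - k) = q ^+ 2 * Q.
    by rewrite -exprD subnKC // -exprD.
  move=> /(_ erefl).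
  have := nN k; have := nN (n.+2 - k)%N.
  move: (N (q ^+ (n.+2 - k))) (D (q ^+ (n.+2 - k))) (N (q ^+ k)) (D (q ^+ k)).
  move: (g (q * q ^+ k)) (g (q ^+ k)) => G2 G1 N2 D2 N1 D1' n2 n1 E.
  have -> : al = (G1 * (N2 * D1') + G2 * (N1 * D2) - be * (D1' * D2)) / (N1 * N2).
    by rewrite -E addrK mulfK // mulf_neq0.
  by field; rewrite n1 n2.
have esum : \sum_(k < n.+3) e1 k = \sum_(k < n.+3) e2 k.
  rewrite big_ord_recr [RHS]big_ord_recl /=.
  have -> : e1 n.+2 = 0 by rewrite /e1 subnn expr0 D1; ring.
  have -> : e2 0%N = 0 by rewrite /e2 expr0 D1; ring.
  rewrite addr0 add0r; apply: eq_bigr => -[k kn] _ /=.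
  by rewrite /bump /= add1n E1 // E2.
have e3sum : phi21conv a c a c n = - \sum_(k < n.+3) e3 k.
  rewrite big_ord_recr big_ord_recl /=.
  have -> : e3 n.+2 = 0 by rewrite /e3 subnn expr0 D1; ring.
  have -> : e3 0%N = 0 by rewrite /e3 expr0 D1; ring.
  rewrite addr0 add0r -sumrN; apply: eq_bigr => -[k kn] _ /=.
  by rewrite /bump /= add1n E3 // opprK.
rewrite -/p -/Q -/al -/be; apply/eqP; rewrite -subr_eq0 e3sum mulrN opprK.
rewrite /phi21conv.
rewrite !mulr_sumr -big_split /=; apply/eqP.
transitivity (\sum_(k < n.+3) (e1 k - e2 k)).
  by apply: eq_bigr => -[k kn] _; rewrite -key.
by rewrite sumrB esum subrr.
Qed.

(** The even coefficients of the product formula 2phi1(a, c; -ac; q, -z) 2phi1(a, c; -ac; q, z) =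
    4phi3(a^2, c^2, ac, acq; a^2 c^2, -ac, -acq; q^2, z^2). *)
Lemma phi21conv_even a c h : qpoch q q h.*2 != 0 ->
  nonqpow (a ^+ 2) -> nonqpow (c ^+ 2) -> nonqpow ((a * c) ^+ 2) ->
  phi21conv a c a c h.*2 =
  qpoch (q ^+ 2) (a ^+ 2) h * qpoch (q ^+ 2) (c ^+ 2) h * qpoch q (a * c) h.*2
  / (qpoch (q ^+ 2) (q ^+ 2) h * qpoch (q ^+ 2) ((a * c) ^+ 2) h
     * qpoch q (- (a * c)) h.*2).
Proof.
move=> + Ha2 Hc2 Hac2.
have Ha := nonqpow_sqr q0 Ha2; have Hc := nonqpow_sqr q0 Hc2.
have Hac := nonqpow_sqrN q0 Hac2.
elim: h => [|h IHh] qn.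
  by rewrite phi21conv0 !qpoch0 !mulr1 divr1.
have := @phi21conv_rec a c h.*2 qn Hac Ha Hc.
have qh : qpoch q q h.*2 != 0.
  by apply: qfact_neq0W qn; rewrite leq_double.
have n1 := qfactS_neq0 (ltnSn h.*2.+1) qn.
have n2 := nonqpow_subX h.*2 Hac2.
have n3 := nonqpow_subX h.*2 Hac; rewrite mulNr opprK in n3.
have n4 := nonqpow_subX h.*2.+1 Hac; rewrite mulNr opprK in n4.
have n5 := qpoch_neq0 h.*2 Hac.
have n6 := qpoch2_neq0 h Hac2.
have n7 : qpoch (q ^+ 2) (q ^+ 2) h != 0.
  by move: qh; rewrite qpoch_bisect mulf_eq0 negb_or expr2 => /andP[].
rewrite IHh // doubleS !qpochS !mulNr !opprK -!exprM.
have -> : (2 * h)%N = h.*2 by rewrite mul2n.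
rewrite -[q ^+ 2 * q ^+ _]exprD add2n => E.
have n34 := mulf_neq0 (mulf_neq0 (mulf_neq0 n1 n2) n3) n4.
apply: (mulfI n34); rewrite E.
move: n1 n2 n3 n4 n5 n6 n7 => {E n34}.
move: (q ^+ h.*2) (q ^+ h.*2.+1) (q ^+ h.*2.+2) => x y z *.
by field; apply/and5P; split=> //; apply/and3P.
Qed.
End Diagonal.

(** * Quotients of reversed shifted factorials *)

Section Reversal.
Variable F : fieldType.
Variable q : F.
Hypothesis q0 : q != 0.
Implicit Types x y : F.
Local Notation nonqpow := (nonqpow q).

Lemma qpoch_rev_neq0 (z : int) y k : y != 0 -> nonqpow y ->
  qpoch q (q ^ z / y) k != 0.
Proof.
move=> y0 Hy; apply/prodf_neq0 => i _; rewrite subr_eq0 eq_sym.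
apply/eqP => E; have /eqP[] := Hy (- (z + i%:Z)).
rewrite -invr_expz; apply: invr_inj; rewrite invr1 -E invfM invrK expfzDr //.
by rewrite exprnP; ring.
Qed.

(** The conditions on x and y differ because x = q, which turns q^(1-n)/x into q^(-n), is not
    generic: for it only (q;q)_(n-k) != 0 is available. *)
Lemma qpoch_rev_ratio x y k n : x != 0 -> y != 0 -> (k <= n)%N ->
  qpoch q x (n - k) != 0 -> nonqpow y ->
  qpoch q (q ^ (1 - n%:Z) / x) k / qpoch q (q ^ (1 - n%:Z) / y) k
  = qpoch q x n * qpoch q y (n - k) / (qpoch q x (n - k) * qpoch q y n)
    * (y / x) ^+ k.
Proof.
move=> x0 y0 kn nx Hy.
have ex := qpoch_rev q0 x0 kn; have ey := qpoch_rev q0 y0 kn.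
have ny := qpoch_rev_neq0 (1 - n%:Z) k y0 Hy.
have nyn := qpoch_neq0 n Hy; have nynk := qpoch_neq0 (n - k) Hy.
move: ex ey ny.
move: (qpoch q (_ / x) k) (qpoch q (_ / y) k) => u v; set r := \prod_(s < k) _.
have r0 : r != 0 by apply/prodf_neq0 => s _; rewrite mulf_neq0 ?expfz_neq0 ?expf_neq0.
move=> ex ey v0.
have -> : u = qpoch q x n * (- x^-1) ^+ k * r / qpoch q x (n - k).
  by rewrite -ex mulfK.
have -> : v = qpoch q y n * (- y^-1) ^+ k * r / qpoch q y (n - k).
  by rewrite -ey mulfK.
rewrite expr_div_n ![(- _^-1) ^+ k]exprNn !exprVn.
have xk : x ^+ k != 0 by rewrite expf_neq0.
have yk : y ^+ k != 0 by rewrite expf_neq0.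
have sk : (-1) ^+ k != 0 :> F by rewrite signr_eq0.
by field; rewrite nx nyn nynk r0 xk yk sk.
Qed.

(** The classical evaluation of (q^(-n);q)_i, with q^(-n) spelled q^(1-n)/q to fit the reversal
    lemmas. Here the product of powers of q has no partner to cancel with and yields the binomial
    exponent. *)
Lemma qpoch_rev_q i n : (i <= n)%N -> qpoch q q n != 0 ->
  (-1) ^+ i * q ^+ (n * i) * qpoch q (q ^ (1 - n%:Z) / q) i
   = qpoch q q n / qpoch q q (n - i) * q ^+ 'C(i, 2).
Proof.
move=> lein qn.
have nN : qpoch q q (n - i) != 0 by apply: qfact_neq0W qn; apply: leq_subr.
apply: (mulIf nN); rewrite -[LHS]mulrA qpoch_rev // [RHS]mulrAC mulfVK //.
rewrite big_split /= prodr_const card_ord -expr_sum -(big_mkord xpredT id) bin2_sum.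
rewrite expfzDr // expr1z -invr_expz -exprnP exprMn exprVn -exprM.
rewrite [(- q^-1) ^+ i]exprNn exprVn.
have nni : q ^+ (n * i) != 0 by rewrite expf_neq0.
have ni : q ^+ i != 0 by rewrite expf_neq0.
transitivity ((-1) ^+ i * (-1) ^+ i * (qpoch q q n * q ^+ 'C(i, 2))).
  by field; rewrite nni ni.
by rewrite -expr2 sqrr_sign mul1r.
Qed.

End Reversal.

(** * The 4phi3 as a multiple of the convolution *)

Section SeriesAsConvolution.
Variable F : fieldType.
Variable q : F.
Hypothesis q0 : q != 0.
Implicit Types x a c A C : F.
Local Notation nonqpow := (nonqpow q).
Local Notation phi21c := (phi21c q).
Local Notation phi21conv := (phi21conv q).
Local Notation expand_coef := (expand_coef q).

Lemma phi43_phi21conv a c A C n : A != 0 -> C != 0 -> qpoch q q n != 0 ->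
  nonqpow A -> nonqpow C -> nonqpow (- (A * C)) ->
  phi43 q n a c (q ^ (1 - n%:Z) / - (A * C)) (q ^ (1 - n%:Z) / A)
     (q ^ (1 - n%:Z) / C) (- (a * c)) q
  = qpoch q q n * qpoch q (- (A * C)) n / (qpoch q A n * qpoch q C n)
    * phi21conv a c A C n.
Proof.
move=> A0 C0 qn HA HC HAC.
have nA := qpoch_neq0 n HA; have nC := qpoch_neq0 n HC.
have AC0 : - (A * C) != 0 by rewrite oppr_eq0 mulf_neq0.
rewrite /phi43 big_mkord mulr_sumr; apply: eq_bigr => -[k /= kn] _.
rewrite ltnS in kn; rewrite /qpochs !big_cons !big_nil !mulr1.
have qk : qpoch q q (n - k) != 0 by apply: qfact_neq0W qn; exact: leq_subr.
have -> : q ^ (- n%:Z) = q ^ (1 - n%:Z) / q.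
  by rewrite expfzDr // expr1z mulrAC divff // mul1r.
have e1 := qpoch_rev_ratio q0 q0 A0 kn qk HA.
have nACk := qpoch_neq0 (n - k) HAC.
have e2 := qpoch_rev_ratio q0 AC0 C0 kn nACk HC.
rewrite /phi21c.
transitivity ((qpoch q (q ^ (1 - n%:Z) / q) k / qpoch q (q ^ (1 - n%:Z) / A) k)
  * (qpoch q (q ^ (1 - n%:Z) / - (A * C)) k / qpoch q (q ^ (1 - n%:Z) / C) k)
  * q ^+ k * (qpoch q a k * qpoch q c k / (qpoch q q k * qpoch q (- (a * c)) k))).
  by rewrite !invfM; ring.
rewrite e1 e2.
(* The alternating sign of the convolution: the two reversals and the argument q contribute (A/q)
   (C/(-AC)) q = -1 per step. *)
have -> : (-1) ^+ k = (A / q) ^+ k * (C / - (A * C)) ^+ k * q ^+ k.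
  by rewrite -!exprMn; congr (_ ^+ k); field; rewrite AC0 q0.
have qk' : qpoch q q k != 0 by apply: qfact_neq0W qn.
rewrite !invfM.
move: (qpoch q (- (a * c)) k)^-1 => z.
by field; rewrite nA nC qk' qk nACk.
Qed.

End SeriesAsConvolution.

(** * The prefactors and the i-dependent part of T *)

Section Factors.
Variable F : fieldType.
Variable q : F.
Hypothesis q0 : q != 0.
Implicit Types x a c A C : F.
Local Notation nonqpow := (nonqpow q).
Local Notation phi21c := (phi21c q).
Local Notation phi21conv := (phi21conv q).
Local Notation expand_coef := (expand_coef q).

(** The prefactor has shifted factorials of length l, [expand_coef] has them of length n. After
    reversal, (x)_l (x q^l)_n = (x)_n (x q^n)_l exchanges the two lengths, for x = A^2 and x =
    -A. *)
Lemma outer_prefactor A l n : A != 0 -> nonqpow (A ^+ 2) ->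
  qpoch q (q ^ (1 - l%:Z) / (A ^+ 2 * q ^+ n)) l * qpoch q (q ^ (1 - l%:Z) / - A) l
  / (qpoch q (q ^ (1 - l%:Z) / A ^+ 2) l * qpoch q (q ^ (1 - l%:Z) / - (A * q ^+ n)) l)
  = qpoch q (A * q ^+ l * A) n * qpoch q (- A) n
    / (qpoch q (A ^+ 2) n * qpoch q (- (A * q ^+ l)) n).
Proof.
move=> A0 HA2.
have HNA := nonqpow_sqrN q0 HA2.
have Al := nonqpowMX q0 l HNA; have An := nonqpowMX q0 n HNA.
have A2n := nonqpowMX q0 n HA2.
have qn0 : q ^+ n != 0 by rewrite expf_neq0.
have e1 := @qpoch_rev_ratio _ _ q0 (A ^+ 2 * q ^+ n) (A ^+ 2) l l
   (mulf_neq0 (expf_neq0 2 A0) qn0) (expf_neq0 2 A0) (leqnn l).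
have e2 := @qpoch_rev_ratio _ _ q0 (- A) (- (A * q ^+ n)) l l.
rewrite subnn !qpoch0 oner_neq0 !mul1r !mulr1 in e1 e2.
rewrite [(qpoch _ _ _ * _)^-1]invfM mulrACA e1 // e2 ?oppr_eq0 ?mulf_neq0 // -?mulNr //.
rewrite mulrACA -exprMn (_ : A ^+ 2 / _ * (_ / - A) = 1); last first.
  by field; rewrite ?qn0 ?oppr_eq0 ?A0.
rewrite expr1n mulr1.
have f1 := qpoch_shift q (A ^+ 2) l n; have f2 := qpoch_shift q (- A) l n.
rewrite (_ : A * q ^+ l * A = A ^+ 2 * q ^+ l); last by ring.
rewrite !mulNr in f2 *.
have n1 := qpoch_neq0 l HA2; have n2 := qpoch_neq0 n HA2.
have n3 := qpoch_neq0 l An; have n4 := qpoch_neq0 n Al.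
rewrite !mulNr in n3 n4.
move: f1 f2 n1 n2 n3 n4.
move: (qpoch q (A ^+ 2) l) (qpoch q (A ^+ 2) n) (qpoch q (- A) l) (qpoch q (- A) n).
move: (qpoch q (A ^+ 2 * q ^+ l) n) (qpoch q (A ^+ 2 * q ^+ n) l).
move: (qpoch q (- (A * q ^+ l)) n) (qpoch q (- (A * q ^+ n)) l).
move=> p s u v x y z w f1 f2 n1 n2 n3 n4.
have -> : u = y * v / x by rewrite -f1; field.
have -> : z = w * s / p by rewrite -f2; field.
by field; rewrite n1 n2 n3 n4.
Qed.

Lemma prod_sub_geom A l i : A != 0 ->
  \prod_(s < i) (A * q ^+ l - A * q ^+ s)
  = (A * q ^+ l) ^+ i * qpoch q (q ^ (- l%:Z)) i.
Proof.
move=> A0; transitivity (\prod_(s < i) (A * q ^+ l * (1 - q ^ (- l%:Z) * q ^+ s))).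
  apply: eq_bigr => s _; rewrite -invr_expz -exprnP.
  by field; rewrite expf_neq0.
by rewrite big_split /= prodr_const card_ord.
Qed.

(* Up to the prefactors of the case l = 0 at b = A q^i, the i-dependent part of
   Tterm is expand_coef. *)
Lemma outer_factor A c C l i N : A != 0 -> qpoch q q (i + N) != 0 ->
  nonqpow (A ^+ 2) -> nonqpow (- (A * c)) -> nonqpow C ->
  nonqpow (- (A * C)) ->
  let n := (i + N)%N in let a := A * q ^+ l in let b := A * q ^+ i in
  qpoch q (a * A) n * qpoch q (- A) n
    / (qpoch q (A ^+ 2) n * qpoch q (- a) n)
  * (qpoch q (- a) n * qpoch q (c * C) n / (qpoch q (- (a * c)) n * qpoch q C n))
  * ((-1) ^+ i * q ^+ (n * i) * a ^+ i
     * ((1 - A ^+ 2 * q ^+ (2 * i) / q) / (1 - A ^+ 2 / q))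
     * (qpoch q (q ^ (- l%:Z)) i * qpoch q (q ^ (1 - n%:Z) / q) i
         * qpoch q (A ^+ 2 / q) i
        / (qpoch q q i * qpoch q (A ^+ 2 * q ^+ n) i * qpoch q (a * A) i)))
  = qpoch q q n * qpoch q (- (A * C)) n / (qpoch q A n * qpoch q C n)
    * expand_coef a A c C n i
    * (qpoch q b N * qpoch q (- b) N * qpoch q (c * C) N
       / (qpoch q q N * qpoch q (- (b * C)) N * qpoch q (- (b * c)) N)).
Proof.
move=> A0 qn HA2 HAc HC HAC n a b.
have HA := nonqpow_sqr q0 HA2; have HNA := nonqpow_sqrN q0 HA2.
have Hac : nonqpow (- (a * c)).
  by rewrite /a (mulrAC A) -mulNr; apply: nonqpowMX.
have HaA : nonqpow (a * A).
  by rewrite /a mulrAC -expr2; apply: nonqpowMX.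
have Ha : nonqpow (- a) by rewrite /a -mulNr; apply: nonqpowMX.
have Hbc : nonqpow (- (b * c)).
  by rewrite /b (mulrAC A) -mulNr; apply: nonqpowMX.
have HbC : nonqpow (- (b * C)).
  by rewrite /b (mulrAC A) -mulNr; apply: nonqpowMX.
rewrite /expand_coef (prod_sub_geom l i A0) -/a.
have eq1 := qpoch_rev_q q0 (leq_addr N i) qn; rewrite -/n in eq1.
have niN : (n - i)%N = N by rewrite addKn.
rewrite niN in eq1 *.
have eA : qpoch q A n = qpoch q A i * qpoch q b N by rewrite qpochD.
have eNA : qpoch q (- A) n = qpoch q (- A) i * qpoch q (- b) N.
  by rewrite qpochD mulNr.
have eAc : qpoch q (- (A * c)) n = qpoch q (- (A * c)) i * qpoch q (- (b * c)) N.
  by rewrite qpochD mulNr; congr (_ * qpoch q (- _) _); rewrite /b; ring.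
have eAC : qpoch q (- (A * C)) n = qpoch q (- (A * C)) i * qpoch q (- (b * C)) N.
  by rewrite qpochD mulNr; congr (_ * qpoch q (- _) _); rewrite /b; ring.
have ecC : qpoch q (c * C) n = qpoch q (c * C * q ^+ N) i * qpoch q (c * C) N.
  by rewrite /n addnC qpochD mulrC.
have eA2 := qpoch_sqr q A i.
have n1 := qpoch_neq0 n HA2; have n2 := qpoch_neq0 n Ha.
have n3 := qpoch_neq0 n Hac; have n4 := qpoch_neq0 n HC.
have n5 := qpoch_neq0 i HaA; have n6 := qpoch_neq0 i (nonqpowMX q0 n HA2).
have n7 := qpoch_neq0 i HAc; have n8 := qpoch_neq0 i HAC.
have n9 := qpoch_neq0 N Hbc; have n10 := qpoch_neq0 N HbC.
have n11 := qpoch_neq0 i HA; have n12 := qpoch_neq0 N (nonqpowMX q0 i HA).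
rewrite -/b in n12.
have n13 : qpoch q q i != 0 by apply: qfact_neq0W qn; exact: leq_addr.
have n14 : qpoch q q N != 0 by apply: qfact_neq0W qn; exact: leq_addl.
have n15 := nonqpow_sub (nonqpowMV q0 HA2).
have n15' : q - A ^+ 2 != 0.
  by rewrite (_ : q - A ^+ 2 = (1 - A ^+ 2 / q) * q) ?mulf_neq0 //; field.
rewrite eA eNA eAc eAC ecC eA2.
transitivity (qpoch q (a * A) n * (qpoch q (- A) i * qpoch q (- b) N) /
(qpoch q (A ^+ 2) n * qpoch q (- a) n) *
(qpoch q (- a) n * (qpoch q (c * C * q ^+ N) i * qpoch q (c * C) N) /
 (qpoch q (- (a * c)) n * qpoch q C n)) *
(a ^+ i * ((1 - A ^+ 2 * q ^+ (2 * i) / q) / (1 - A ^+ 2 / q)) *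
 (qpoch q (q ^ (- l%:Z)) i * qpoch q (A ^+ 2 / q) i /
  (qpoch q q i * qpoch q (A ^+ 2 * q ^+ n) i * qpoch q (a * A) i)))
 * ((-1) ^+ i * q ^+ (n * i) * qpoch q (q ^ (1 - n%:Z) / q) i)).
  by move: (_ / (1 - A ^+ 2 / q)) (_ / _) (_ / _) (_^-1) => *; ring.
rewrite eq1.
move: qn n1 n2 n3 n4 n5 n6 n7 n8 n9 n10 n11 n12 n13 n14.
move: (qpoch q q n) (qpoch q (A ^+ 2) n) (qpoch q (- a) n) (qpoch q (- (a * c)) n) (qpoch q C n) (qpoch q (a * A) i)
 (qpoch q (A ^+ 2 * q ^+ n) i) (qpoch q (- (A * c)) i) (qpoch q (- (A * C)) i)
 (qpoch q (- (b * c)) N) (qpoch q (- (b * C)) N) (qpoch q A i) (qpoch q b N)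
 (qpoch q q i) (qpoch q q N) => p1 p2 p3 p4 p5 p6 p7 p8 p9 p10 p11 p12 p13 p14 p15
  n0 n1 n2 n3 n4 n5 n6 n7 n8 n9 n10 n11 n12 n13 n14.
field.
by rewrite q0 n15' n1 n2 n3 n4 n5 n6 n7 n8 n9 n10 n11 n12 n13 n14.
Qed.
End Factors.

(** * The j-dependent part of T *)

Section InnerFactor.
Variable F : fieldType.
Variable q : F.
Hypothesis q0 : q != 0.
Implicit Types x a c A C b : F.
Local Notation phi21c := (phi21c q).
Local Notation phi21conv := (phi21conv q).
Local Notation expand_coef := (expand_coef q).

(** The powers of q and c left over by the reversals in the inner factor; the exponents match
    because j^2 = 2 binom(j,2) + j. *)
Lemma inner_factor_powers c m j h : c != 0 ->
  q ^+ ((m + (j + h.*2)) * j) / q ^+ 'C(j, 2) * c ^+ (j + h.*2)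
    * (- q^-1) ^+ j * (c ^+ 2 * q ^+ (2 * j))^-1 ^+ h
  = (-1) ^+ j * (c * q ^+ m) ^+ j * q ^+ 'C(j, 2).
Proof.
move=> c0; rewrite (exprNn q^-1 j) !exprVn !exprMn -!exprM exprD -mul2n.
have -> : ((m + (j + 2 * h)) * j = m * j + 'C(j, 2) + 'C(j, 2) + j + 2 * j * h)%N.
  by have : ('C(j, 2) + 'C(j, 2) + j = j * j)%N; [elim: j => [|j IHj] //; rewrite binS bin1; nia | nia].
rewrite !exprD expr0.
field.
by rewrite !expf_neq0.
Qed.

(** Counterpart of [outer_factor] for the second expansion. The order N - j = 2h of the remaining
    diagonal convolution is even, so [phi21conv_even] supplies the base-q^2 part of T; the sign
    (-1)^j is the sign (-1)^N of the reversal that precedes this expansion. *)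
Lemma inner_factor b c m j h : b != 0 -> c != 0 -> 
  let N := (j + h.*2)%N in let C := c * q ^+ m in
  qpoch q q N != 0 ->
  nonqpow q (b ^+ 2) -> nonqpow q (c ^+ 2) -> nonqpow q ((c * b) ^+ 2) ->
  qpoch q b N * qpoch q (- b) N * qpoch q (c * C) N
       / (qpoch q q N * qpoch q (- (b * C)) N * qpoch q (- (b * c)) N)
  * (q ^+ ((m + N) * j) / q ^+ 'C(j, 2) * c ^+ N)
  * (qpoch q (q ^ (- m%:Z)) j * qpoch q (q ^ (1 - N%:Z) / q) j
     * qpoch q (q ^ (1 - N%:Z) / b ^+ 2) j * qpoch q c j * qpoch q (- c) j
    / (qpoch q q j * qpoch q (q ^ (1 - N%:Z) / b) j * qpoch q (q ^ (1 - N%:Z) / - b) j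
       * qpoch q (c * C) j * qpoch q (c ^+ 2 / q * q ^+ j) j))
  * (qpoch (q ^+ 2) q h
     * qpoch (q ^+ 2) ((q ^+ 2) ^ (1 - h%:Z) / ((c * q ^+ j * b) ^+ 2 * q ^+ h.*2)) h
    / (qpoch (q ^+ 2) ((q ^+ 2) ^ (1 - h%:Z) / (b ^+ 2 * q ^+ h.*2)) h
       * qpoch (q ^+ 2) (c ^+ 2 * q ^+ (2 * j) * q) h))
  = (-1) ^+ j * expand_coef C c b b N j
    * phi21conv (c * q ^+ j) b (c * q ^+ j) b h.*2.
Proof.
move=> b0 c0 N C qN Hb2 Hc2 Hcb2.
have Hb := nonqpow_sqr q0 Hb2; have HNb := nonqpow_sqrN q0 Hb2.
have Hcb := nonqpow_sqrN q0 Hcb2.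
have qj : qpoch q q j != 0 by apply: qfact_neq0W qN; rewrite leq_addr.
have q2h : qpoch q q h.*2 != 0 by apply: qfact_neq0W qN; rewrite leq_addl.
pose p := c * q ^+ j * b.
have Hcj2 : nonqpow q ((c * q ^+ j) ^+ 2).
  by rewrite exprMn -exprM; apply: nonqpowMX.
have Hp2 : nonqpow q (p ^+ 2).
  by rewrite /p mulrAC exprMn -exprM; apply: nonqpowMX.
have Hp : nonqpow q (- p) by apply: nonqpow_sqrN.
rewrite phi21conv_even // -/p.
have NjE : (N - j)%N = h.*2 by rewrite addKn.
rewrite /expand_coef (prod_sub_geom q0 m j c0) -/C NjE.
have Hq20 : q ^+ 2 != 0 by rewrite expf_neq0.
have qh20 : q ^+ h.*2 != 0 by rewrite expf_neq0.
have b20 : b ^+ 2 != 0 by rewrite expf_neq0.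
have p0 : p != 0 by rewrite /p !mulf_neq0 // expf_neq0.
have jN : (j <= N)%N by apply: leq_addr.
have r1 := @qpoch_rev_ratio _ q q0 q b j N q0 b0 jN.
have r2 := @qpoch_rev_ratio _ q q0 (b ^+ 2) (- b) j N b20.
rewrite NjE in r1 r2.
have {}r1 := r1 q2h Hb.
have {}r2 := r2 _ jN (qpoch_neq0 h.*2 Hb2) HNb; rewrite oppr_eq0 in r2.
have {}r2 := r2 b0.
(* The last quotient is reversed in base q^2; genericity carries over since powers of q^2 are even
   powers of q. *)
have Hbh : nonqpow (q ^+ 2) (b ^+ 2 * q ^+ h.*2).
  move=> k; apply/eqP => E; have /eqP[] := Hb2 (h.*2%:Z + (2 * k)).
  by rewrite expfzDr // mulrA -exprz_exp; exact: E.
have Hph : nonqpow (q ^+ 2) (p ^+ 2 * q ^+ h.*2).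
  move=> k; apply/eqP => E; have /eqP[] := Hp2 (h.*2%:Z + (2 * k)).
  by rewrite expfzDr // mulrA -exprz_exp; exact: E.
have r3 := @qpoch_rev_ratio _ (q ^+ 2) Hq20 (p ^+ 2 * q ^+ h.*2) (b ^+ 2 * q ^+ h.*2) h h.
rewrite subnn !qpoch0 oner_neq0 !mul1r !mulr1 in r3.
have {}r3 := r3 (mulf_neq0 (expf_neq0 2 p0) qh20) (mulf_neq0 b20 qh20) (leqnn h) isT Hbh.
transitivity (
  qpoch q b N * qpoch q (- b) N * qpoch q (c * C) N /
(qpoch q q N * qpoch q (- (b * C)) N * qpoch q (- (b * c)) N)
 * (qpoch q (q ^ (- m%:Z)) j * qpoch q c j * qpoch q (- c) j /
  (qpoch q q j * qpoch q (c * C) j * qpoch q (c ^+ 2 / q * q ^+ j) j))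
 * (qpoch (q ^+ 2) q h / qpoch (q ^+ 2) (c ^+ 2 * q ^+ (2 * j) * q) h)
 * ((qpoch q (q ^ (1 - N%:Z) / q) j / qpoch q (q ^ (1 - N%:Z) / b) j)
   * (qpoch q (q ^ (1 - N%:Z) / b ^+ 2) j / qpoch q (q ^ (1 - N%:Z) / - b) j)
   * (qpoch (q ^+ 2) ((q ^+ 2) ^ (1 - h%:Z) / (p ^+ 2 * q ^+ h.*2)) h
     / qpoch (q ^+ 2) ((q ^+ 2) ^ (1 - h%:Z) / (b ^+ 2 * q ^+ h.*2)) h)
  * (q ^+ ((m + N) * j) / q ^+ 'C(j, 2) * c ^+ N))).
  by rewrite !invfM; ring.
rewrite r1 r2 r3.
have ep : (b / q) ^+ j * (- b / b ^+ 2) ^+ j *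
   ((b ^+ 2 * q ^+ h.*2) / (p ^+ 2 * q ^+ h.*2)) ^+ h
   * (q ^+ ((m + N) * j) / q ^+ 'C(j, 2) * c ^+ N)
   = (-1) ^+ j * C ^+ j * q ^+ 'C(j, 2).
  rewrite -(inner_factor_powers m j h c0) -exprMn.
  have -> : b / q * (- b / b ^+ 2) = - q^-1 by field; rewrite b0 q0.
  have -> : b ^+ 2 * q ^+ h.*2 / (p ^+ 2 * q ^+ h.*2) = (c ^+ 2 * q ^+ (2 * j))^-1.
    rewrite /p !exprMn mulnC exprM; field.
    by rewrite b0 c0 qh20 expf_neq0.
  by rewrite -/N; ring.
transitivity (
qpoch q b N * qpoch q (- b) N * qpoch q (c * C) N /
(qpoch q q N * qpoch q (- (b * C)) N * qpoch q (- (b * c)) N)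
 * (qpoch q (q ^ (- m%:Z)) j * qpoch q c j * qpoch q (- c) j /
  (qpoch q q j * qpoch q (c * C) j * qpoch q (c ^+ 2 / q * q ^+ j) j))
 * (qpoch (q ^+ 2) q h / qpoch (q ^+ 2) (c ^+ 2 * q ^+ (2 * j) * q) h)
 * (qpoch q q N * qpoch q b h.*2 / (qpoch q q h.*2 * qpoch q b N)
  * (qpoch q (b ^+ 2) N * qpoch q (- b) h.*2 / (qpoch q (b ^+ 2) h.*2 * qpoch q (- b) N))
  * (qpoch (q ^+ 2) (p ^+ 2 * q ^+ h.*2) h / qpoch (q ^+ 2) (b ^+ 2 * q ^+ h.*2) h)
  * ((-1) ^+ j * C ^+ j * q ^+ 'C(j, 2)))).
  by rewrite -ep; ring.
have ebh : qpoch q b h.*2 * qpoch q (- b) h.*2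
    = qpoch (q ^+ 2) (b ^+ 2) h * qpoch (q ^+ 2) (b ^+ 2 * q ^+ h.*2) h.
  by rewrite -qpoch_sqr -addnn qpochD -exprM mul2n -addnn.
have eph : qpoch q p h.*2 * qpoch q (- p) h.*2
    = qpoch (q ^+ 2) (p ^+ 2) h * qpoch (q ^+ 2) (p ^+ 2 * q ^+ h.*2) h.
  by rewrite -qpoch_sqr -addnn qpochD -exprM mul2n -addnn.
have eb2 : qpoch q (b * b * q ^+ h.*2) j = qpoch q (b ^+ 2) N / qpoch q (b ^+ 2) h.*2.
  by rewrite /N addnC qpochD -expr2 [RHS]mulrC mulKf // qpoch_neq0.
have eqh : qpoch q q h.*2 = qpoch (q ^+ 2) q h * qpoch (q ^+ 2) (q ^+ 2) h.
  by rewrite qpoch_bisect -expr2.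
have ebc : qpoch q (- (b * c)) N = qpoch q (- (c * b)) j * qpoch q (- p) h.*2.
  by rewrite qpochD [b * c]mulrC; congr (_ * qpoch q _ _); rewrite /p; ring.
have ebc' : qpoch q (- (c * b)) N = qpoch q (- (c * b)) j * qpoch q (- p) h.*2.
  by rewrite -ebc [b * c]mulrC.
have ec2 := qpoch_sqr q c j.
have nc2N := qpoch_neq0 N Hc2; have nc2j := qpoch_neq0 j (nonqpowMX q0 N Hc2).
have Hc2q := nonqpowMV q0 Hc2.
have nc2V := nonqpow_sub Hc2q.
have nc2q := qpoch_neq0 j Hc2q.
have nc2qj := qpoch_neq0 j (nonqpowMX q0 j Hc2q).
have nc22 : qpoch (q ^+ 2) (c ^+ 2 * q ^+ (2 * j) * q) h != 0.
  by apply: qpoch2_neq0; apply: nonqpowMl => //; apply: nonqpowMX.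
(* Both sides are (1 - c^2/q) (c^2;q)_(2j+2h), cut into runs of consecutive factors in two ways.
   This reconciles the parameter q^(j-1) c^2 of T with the very-well-poised factor of
   [expand_coef]. *)
have ec : qpoch (q ^+ 2) (c ^+ 2 * q ^+ (2 * j) * q) h * qpoch (q ^+ 2) ((c * q ^+ j) ^+ 2) h
  * ((1 - c ^+ 2 * q ^+ (2 * j) / q) * (qpoch q (c ^+ 2 / q) j * qpoch q (c ^+ 2 / q * q ^+ j) j))
  = (1 - c ^+ 2 / q) * (qpoch q (c ^+ 2) N * qpoch q (c ^+ 2 * q ^+ N) j).
  rewrite -!qpochD.
  have -> : (N + j = (j + j) + h.*2)%N by rewrite /N addnAC.
  rewrite [in RHS]qpochD qpoch_bisect.
  have -> : (c * q ^+ j) ^+ 2 = c ^+ 2 * q ^+ (j + j).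
    by rewrite exprMn -exprM muln2 -addnn.
  rewrite addnn -mul2n.
  have e0 : qpoch q (c ^+ 2 / q) (2 * j) * (1 - c ^+ 2 / q * q ^+ (2 * j))
     = (1 - c ^+ 2 / q) * qpoch q (c ^+ 2) (2 * j).
    by rewrite -qpochS qpochSl mulfVK.
  transitivity (qpoch (q ^+ 2) (c ^+ 2 * q ^+ (2 * j) * q) h
    * qpoch (q ^+ 2) (c ^+ 2 * q ^+ (2 * j)) h
    * ((1 - c ^+ 2 / q) * qpoch q (c ^+ 2) (2 * j))); last by ring.
  by rewrite -e0 (mulrAC (c ^+ 2) (q ^+ (2 * j)) q^-1); ring.
have HcC : nonqpow q (c * C) by rewrite /C mulrA -expr2; apply: nonqpowMX.
have HbC : nonqpow q (- (b * C)).
  rewrite (_ : - (b * C) = - (c * b) * q ^+ m); last by rewrite /C; ring.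
  exact: nonqpowMX.
have n1 := qpoch_neq0 j HcC; have n2 := qpoch_neq0 N HbC.
have n3 := qpoch_neq0 j Hcb; have n4 := qpoch_neq0 h.*2 Hp.
have n5 := qpoch_neq0 h.*2 Hb2.
have n6 := qpoch_neq0 N Hb; have n7 := qpoch_neq0 N HNb.
have n8 := qpoch2_neq0 h Hp2.
have n9 : qpoch (q ^+ 2) (b ^+ 2 * q ^+ h.*2) h != 0 by apply: qpoch_neq0.
have n10 : qpoch (q ^+ 2) (q ^+ 2) h != 0.
  by move: q2h; rewrite eqh mulf_eq0 negb_or => /andP[].
have n11 : qpoch (q ^+ 2) q h != 0.
  by move: q2h; rewrite eqh mulf_eq0 negb_or => /andP[].
have nV2 : q - c ^+ 2 != 0.
  by rewrite (_ : q - c ^+ 2 = (1 - c ^+ 2 / q) * q) ?mulf_neq0 //; field.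
rewrite ebc ebc' eb2 ec2 eqh (mulrC C c) (mulrC b C) in ep *.
have -> : - (c * b) = - (b * c) by rewrite mulrC.
rewrite (mulrC c b) (mulrC b C) in n2 n3.
have nw := nonqpow_subX (2 * j) Hc2q; rewrite (mulrAC (c ^+ 2) q^-1) in nw.
have nNb2 := qpoch_neq0 h.*2 HNb.
have -> : qpoch q p h.*2 = qpoch (q ^+ 2) (p ^+ 2) h * qpoch (q ^+ 2) (p ^+ 2 * q ^+ h.*2) h
   / qpoch q (- p) h.*2 by rewrite -eph mulfK.
have -> : qpoch q b h.*2 = qpoch (q ^+ 2) (b ^+ 2) h * qpoch (q ^+ 2) (b ^+ 2 * q ^+ h.*2) h
   / qpoch q (- b) h.*2 by rewrite -ebh mulfK.
have nc3 := mulf_neq0 nc22 (mulf_neq0 nw (mulf_neq0 nc2q nc2qj)).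
have -> : qpoch (q ^+ 2) ((c * q ^+ j) ^+ 2) h
  = (1 - c ^+ 2 / q) * (qpoch q (c ^+ 2) N * qpoch q (c ^+ 2 * q ^+ N) j)
    / (qpoch (q ^+ 2) (c ^+ 2 * q ^+ (2 * j) * q) h * ((1 - c ^+ 2 * q ^+ (2 * j) / q) *
     (qpoch q (c ^+ 2 / q) j * qpoch q (c ^+ 2 / q * q ^+ j) j))).
  by rewrite -ec -[X in X / _]mulrA [X in X / _]mulrCA mulfK.
move: qj qN nw nNb2 nc2N nc2j nc2V nc2q nc2qj nc22 n1 n2 n3 n4 n5 n6 n7 n8 n9 n10 n11.
clear -F.
move: (qpoch q q j) (qpoch q q N) (1 - c ^+ 2 * q ^+ (2 * j) / q) (qpoch q (- b) h.*2)
  (qpoch q (c ^+ 2) N) (qpoch q (c ^+ 2 * q ^+ N) j) (1 - c ^+ 2 / q)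
  (qpoch q (c ^+ 2 / q) j) (qpoch q (c ^+ 2 / q * q ^+ j) j)
  (qpoch (q ^+ 2) (c ^+ 2 * q ^+ (2 * j) * q) h) (qpoch q (c * C) j)
  (qpoch q (- (C * b)) N) (qpoch q (- (b * c)) j) (qpoch q (- p) h.*2)
  (qpoch q (b ^+ 2) h.*2) (qpoch q b N) (qpoch q (- b) N)
  (qpoch (q ^+ 2) (p ^+ 2) h) (qpoch (q ^+ 2) (b ^+ 2 * q ^+ h.*2) h)
  (qpoch (q ^+ 2) (q ^+ 2) h) (qpoch (q ^+ 2) q h)
  => p1 p2 p3 p4 p5 p6 p7 p8 p9 p10 p11 p12 p13 p14 p15 p16 p17 p18 p19 p20 p21
  h1 h2 h3 h4 h5 h6 h7 h8 h9 h10 h11 h12 h13 h14 h15 h16 h17 h18 h19 h20 h21.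
field.
by rewrite h1 h2 h3 h4 h5 h6 h7 h8 h9 h10 h11 h12 h13 h14 h15 h16 h17 h18 h19 h20 h21.
Qed.
End InnerFactor.

(** Breaks integer powers of q into natural powers and their inverses, the form that [ring] and
    [field] can compare. *)
Ltac zpow q0 :=
  rewrite ?PoszD ?opprD ?mulrN ?mulNr ?mulr_natl ?mulr2n ?opprD ?addrA ?expfzDr ?sqrf_eq0 ?q0 //;
  rewrite -?invr_expz ?expr1z -?exprnP ?expr1 -?addnn ?exprD ?exprMn -?exprM ?exprM.

(** * The double sum for generic a and c *)

Section GenericIdentity.
Variable F : fieldType.
Variable q : F.
Hypothesis q0 : q != 0.
Implicit Types x a c A C b : F.
Local Notation phi21c := (phi21c q).
Local Notation phi21conv := (phi21conv q).
Local Notation expand_coef := (expand_coef q).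

(** Writing n = i + j + 2h builds in the range and parity conditions and removes the truncated
    subtractions; the terminating and inverse parameters then take the reversed form q^(1-N)/x of
    the factor lemmas. *)
Lemma Tterm_split A c l m i j h : A != 0 -> c != 0 ->
  (2%:R != 0 :> F) ->
  let N := (j + h.*2)%N in let n := (i + N)%N in
  let a := A * q ^+ l in let b := A * q ^+ i in let C := c * q ^+ m in
  Tterm q a c l m n i j =
  ((-1) ^+ i * q ^+ (n * i) * a ^+ i
     * ((1 - A ^+ 2 * q ^+ (2 * i) / q) / (1 - A ^+ 2 / q))
     * (qpoch q (q ^ (- l%:Z)) i * qpoch q (q ^ (1 - n%:Z) / q) i
         * qpoch q (A ^+ 2 / q) i
        / (qpoch q q i * qpoch q (A ^+ 2 * q ^+ n) i * qpoch q (a * A) i)))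
  * (q ^+ ((m + N) * j) / q ^+ 'C(j, 2) * c ^+ N)
  * (qpoch q (q ^ (- m%:Z)) j * qpoch q (q ^ (1 - N%:Z) / q) j
     * qpoch q (q ^ (1 - N%:Z) / b ^+ 2) j * qpoch q c j * qpoch q (- c) j
    / (qpoch q q j * qpoch q (q ^ (1 - N%:Z) / b) j * qpoch q (q ^ (1 - N%:Z) / - b) j
       * qpoch q (c * C) j * qpoch q (c ^+ 2 / q * q ^+ j) j))
  * (qpoch (q ^+ 2) q h
     * qpoch (q ^+ 2) ((q ^+ 2) ^ (1 - h%:Z) / ((c * q ^+ j * b) ^+ 2 * q ^+ h.*2)) h
    / (qpoch (q ^+ 2) ((q ^+ 2) ^ (1 - h%:Z) / (b ^+ 2 * q ^+ h.*2)) h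
       * qpoch (q ^+ 2) (c ^+ 2 * q ^+ (2 * j) * q) h)).
Proof.
move=> A0 c0 two N n a b C.
have nij : (n - i - j)%N = h.*2 by rewrite /n addKn addKn.
have ni : (n - i)%N = N by rewrite addKn.
rewrite /Tterm /n addnA leq_addr -addnA -/N -/n nij ni doubleK.
have -> : chi F h.*2 = 1.
  by rewrite /chi -signr_odd odd_double expr0 -mulr2n divff.
have -> : q ^ (n%:Z * i%:Z + (m%:Z + n%:Z - i%:Z) * j%:Z - 'C(j, 2)%:Z)
    = q ^+ (n * i) * (q ^+ ((m + N) * j) / q ^+ 'C(j, 2)).
  have -> : (m%:Z + n%:Z - i%:Z) = (m + N)%N%:Z.
    by rewrite /n !PoszD; ring.
  by rewrite -!PoszM expfzDr // expfzDr // -invr_expz mulrA.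
have -> : q ^ (2 * i%:Z - 2 * l%:Z - 1) * a ^+ 2 = A ^+ 2 * q ^+ (2 * i) / q.
  by rewrite /C /a /b /n /N; zpow q0; field; rewrite ?q0 ?A0 ?expf_neq0.
have -> : q ^ (- 2 * l%:Z - 1) * a ^+ 2 = A ^+ 2 / q.
  by rewrite /C /a /b /n /N; zpow q0; field; rewrite ?q0 ?A0 ?expf_neq0.
have -> : q ^ (- n%:Z) = q ^ (1 - n%:Z) / q.
  by rewrite /C /a /b /n /N; zpow q0; field; rewrite ?q0 ?A0 ?expf_neq0.
have -> : q ^ (n%:Z - 2 * l%:Z) * a ^+ 2 = A ^+ 2 * q ^+ n.
  by rewrite /C /a /b /n /N; zpow q0; field; rewrite ?q0 ?A0 ?expf_neq0.
have -> : q ^ (- l%:Z) * a ^+ 2 = a * A.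
  by rewrite /C /a /b /n /N; zpow q0; field; rewrite ?q0 ?A0 ?expf_neq0.
have -> : q ^ (i%:Z - n%:Z) = q ^ (1 - N%:Z) / q.
  by rewrite /C /a /b /n /N; zpow q0; field; rewrite ?q0 ?A0 ?expf_neq0.
have -> : q ^ (1 + 2 * l%:Z - n%:Z - i%:Z) / a ^+ 2 = q ^ (1 - N%:Z) / b ^+ 2.
  by rewrite /C /a /b /n /N; zpow q0; field; rewrite ?q0 ?A0 ?expf_neq0.
have -> : q ^ (1 + l%:Z - n%:Z) / a = q ^ (1 - N%:Z) / b.
  by rewrite /C /a /b /n /N; zpow q0; field; rewrite ?q0 ?A0 ?expf_neq0.
have -> : - q ^ (1 + l%:Z - n%:Z) / a = q ^ (1 - N%:Z) / - b.
  by rewrite /C /a /b /n /N; zpow q0; field; rewrite ?oppr_eq0 ?mulf_neq0 ?A0 ?expf_neq0.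
have -> : q ^ m%:Z * c ^+ 2 = c * C.
  by rewrite /C /a /b /n /N; zpow q0; ring.
have -> : q ^ (j%:Z - 1) * c ^+ 2 = c ^+ 2 / q * q ^+ j.
  by rewrite /C /a /b /n /N; zpow q0; field; rewrite ?q0 ?A0 ?expf_neq0.
have -> : q ^ (2 + 2 * l%:Z - 2 * n%:Z) / (a ^+ 2 * c ^+ 2) =
   (q ^+ 2) ^ (1 - h%:Z) / ((c * q ^+ j * b) ^+ 2 * q ^+ h.*2).
  by rewrite /C /a /b /n /N; zpow q0; field; rewrite ?q0 ?c0 ?A0 ?expf_neq0.
have -> : q ^ (2 + 2 * l%:Z - 2 * n%:Z + 2 * j%:Z) / a ^+ 2 =
   (q ^+ 2) ^ (1 - h%:Z) / (b ^+ 2 * q ^+ h.*2).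
  by rewrite /C /a /b /n /N; zpow q0; field; rewrite ?q0 ?c0 ?A0 ?expf_neq0.
have -> : q ^ (1 + 2 * j%:Z) * c ^+ 2 = c ^+ 2 * q ^+ (2 * j) * q.
  by rewrite /C /a /b /n /N; zpow q0; rewrite ?expr0; ring.
by rewrite /qpochs !big_cons !big_nil !mulr1 !invfM; ring.
Qed.

Lemma qpoch_negpow_eq0 l i : (l < i)%N -> qpoch q (q ^ (- l%:Z)) i = 0.
Proof.
move=> li; rewrite /qpoch (bigD1 (Ordinal li)) //= exprnP -expfzDr //.
by rewrite addNr expr0z subrr mul0r.
Qed.

Lemma Tterm_eq0 a c l m n i j : (l < i)%N || (m < j)%N ->
  Tterm q a c l m n i j = 0.
Proof.
rewrite /Tterm; case: ifP => // _.
rewrite /qpochs !big_cons !big_nil => /orP[] /qpoch_negpow_eq0 ->;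
by rewrite !(mul0r, mulr0).
Qed.

Lemma Tterm_gt a c l m n i j : (n < i + j)%N -> Tterm q a c l m n i j = 0.
Proof. by rewrite /Tterm ltnNge => /negPf ->. Qed.

Lemma Tterm_odd a c l m n i j : odd (n - i - j) -> Tterm q a c l m n i j = 0.
Proof.
move=> o; rewrite /Tterm; case: ifP => // _.
by rewrite /chi -(signr_odd F (n - i - j)) o expr1 subrr mul0r mulr0.
Qed.

(** The sums of the statement stop at l and m, the expansions at n and n - i. As the terms vanish
    beyond either bound, both sums equal the one up to l + n. *)
Lemma sum_ord_trunc (R : nmodType) (G : nat -> R) (l n : nat) :
  (forall i, (l < i)%N -> G i = 0) -> (forall i, (n < i)%N -> G i = 0) ->
  \sum_(0 <= i < l.+1) G i = \sum_(i < n.+1) G i.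
Proof.
move=> Hl Hn; rewrite -(big_mkord xpredT G).
have H2 k : (forall i, (k < i)%N -> G i = 0) -> (k <= l + n)%N ->
   \sum_(0 <= i < k.+1) G i = \sum_(0 <= i < (l + n).+1) G i.
  move=> Hk kl; rewrite [RHS](@big_cat_nat _ _ _ k.+1) //=.
  rewrite [X in _ = _ + X]big_nat_cond [X in _ = _ + X]big1 ?addr0 // => i.
  by rewrite andbT => /andP[ki _]; apply: Hk.
by rewrite (H2 l) ?leq_addr // -(H2 n) ?leq_addl.
Qed.

Theorem double_sum_generic a c (l m n : nat) : a != 0 -> c != 0 ->
  (2%:R != 0 :> F) -> qpoch q q n != 0 ->
  nonqpow q (a ^+ 2) -> nonqpow q (c ^+ 2) -> nonqpow q ((a * c) ^+ 2) ->
  phi43 q n a c (- q ^ (1 + l%:Z - m%:Z - n%:Z) / (a * c))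
    (q ^ (1 + l%:Z - n%:Z) / a) (q ^ (1 - m%:Z - n%:Z) / c) (- (a * c)) q
  = qpochs q [:: q ^ (1 + l%:Z - n%:Z) / a ^+ 2; - q / a] l
      / qpochs q [:: q ^ (1 + l%:Z) / a ^+ 2; - q ^ (1 - n%:Z) / a] l
    * (qpochs q [:: - a; q ^ m%:Z * c ^+ 2] n
      / qpochs q [:: - (a * c); q ^ m%:Z * c] n)
    * \sum_(0 <= i < l.+1) \sum_(0 <= j < m.+1) Tterm q a c l m n i j.
Proof.
move=> a0 c0 two qn Ha2 Hc2 Hac2.
(* The expansion goes upward from A to A q^l, so a is traded for A q^l with A as the free
   parameter. *)
pose A := a * q ^ (- l%:Z).
have ql : q ^+ l != 0 by rewrite expf_neq0.
have qm : q ^+ m != 0 by rewrite expf_neq0.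
have aE : a = A * q ^+ l by rewrite /A -invr_expz -exprnP mulfVK.
have A0 : A != 0 by rewrite mulf_neq0 // expfz_neq0.
have ql2 : (q ^ (- l%:Z)) ^+ 2 = q ^ (- l%:Z - l%:Z) by rewrite expfzDr // expr2.
have HA2 : nonqpow q (A ^+ 2) by rewrite /A exprMn ql2; apply: nonqpowM.
have HcA2 : nonqpow q ((c * A) ^+ 2).
  by rewrite /A mulrCA mulrA exprMn ql2; apply: nonqpowM.
move: aE a0 Ha2 Hac2 => ->.
move: (A) A0 HA2 HcA2 => {}A A0 HA2 HcA2 a0 Ha2 Hac2 {a}.
pose C := c * q ^+ m.
have C0 : C != 0 by rewrite mulf_neq0.
have Hc := nonqpow_sqr q0 Hc2; have HA := nonqpow_sqr q0 HA2.
have HcA := nonqpow_sqrN q0 HcA2.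
have HAc : nonqpow q (- (A * c)) by rewrite mulrC.
have HC : nonqpow q C by apply: nonqpowMX.
have HAC : nonqpow q (- (A * C)) by rewrite /C mulrA -mulNr; apply: nonqpowMX.
rewrite (_ : - q ^ (1 + l%:Z - m%:Z - n%:Z) / (A * q ^+ l * c) = q ^ (1 - n%:Z) / - (A * C)); last first.
  by rewrite /C; zpow q0; field; rewrite ?oppr_eq0 ?mulf_neq0 ?c0 ?A0 ?expf_neq0.
rewrite (_ : q ^ (1 + l%:Z - n%:Z) / (A * q ^+ l) = q ^ (1 - n%:Z) / A); last first.
  by zpow q0; field; rewrite ?mulf_neq0 ?A0 ?expf_neq0.
rewrite (_ : q ^ (1 - m%:Z - n%:Z) / c = q ^ (1 - n%:Z) / C); last first.
  by rewrite /C; zpow q0; field; rewrite ?mulf_neq0 ?c0 ?expf_neq0.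
rewrite (_ : q ^ (1 + l%:Z - n%:Z) / (A * q ^+ l) ^+ 2 = q ^ (1 - l%:Z) / (A ^+ 2 * q ^+ n)); last first.
  by zpow q0; field; rewrite ?mulf_neq0 ?A0 ?expf_neq0.
rewrite (_ : - q / (A * q ^+ l) = q ^ (1 - l%:Z) / - A); last first.
  by zpow q0; field; rewrite ?oppr_eq0 ?mulf_neq0 ?A0 ?expf_neq0.
rewrite (_ : q ^ (1 + l%:Z) / (A * q ^+ l) ^+ 2 = q ^ (1 - l%:Z) / A ^+ 2); last first.
  by zpow q0; field; rewrite ?mulf_neq0 ?A0 ?expf_neq0.
rewrite (_ : - q ^ (1 - n%:Z) / (A * q ^+ l) = q ^ (1 - l%:Z) / - (A * q ^+ n)); last first.
  by zpow q0; field; rewrite ?oppr_eq0 ?mulf_neq0 ?A0 ?expf_neq0.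
rewrite (_ : q ^ m%:Z * c ^+ 2 = c * C); last by rewrite /C; zpow q0; ring.
rewrite (_ : q ^ m%:Z * c = C); last by rewrite /C mulrC.
rewrite phi43_phi21conv // phi21conv_expand //.
have Tsum i : (i <= n)%N -> \sum_(0 <= j < m.+1) Tterm q (A * q ^+ l) c l m n i j
    = \sum_(j < (n - i).+1) Tterm q (A * q ^+ l) c l m n i j.
  move=> lein; apply: sum_ord_trunc => j lj.
    by rewrite Tterm_eq0 ?lj ?orbT.
  by rewrite Tterm_gt // -ltn_subLR.
rewrite (@sum_ord_trunc _ (fun i => \sum_(0 <= j < m.+1) Tterm q (A * q ^+ l) c l m n i j) l n); last first.
- move=> i ni; apply: big1_seq => j _; apply: Tterm_gt; exact: ltn_addr.
- by move=> i li; apply: big1_seq => j _; rewrite Tterm_eq0 ?li.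
rewrite !mulr_sumr; apply: eq_bigr => -[i /= ilen] _; rewrite ltnS in ilen.
pose b := A * q ^+ i; rewrite -/b.
have b0 : b != 0 by rewrite mulf_neq0 // expf_neq0.
have Hb2 : nonqpow q (b ^+ 2) by rewrite exprMn -exprM; apply: nonqpowMX.
have Hcb2 : nonqpow q ((c * b) ^+ 2).
  by rewrite mulrA exprMn -exprM; apply: nonqpowMX.
have Hb := nonqpow_sqr q0 Hb2; have Hcb := nonqpow_sqrN q0 Hcb2.
have qN : qpoch q q (n - i) != 0 by apply: qfact_neq0W qn; apply: leq_subr.
(* Reversal and symmetry turn (b, c; b, C) into (C, b; c, b); with C = c q^m the same expansion
   applies, c now playing the part of A and m that of l. *)
rewrite Tsum // (phi21conv_rev q b c) (phi21conv_sym q b C) phi21conv_expand //; symmetry.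
rewrite !mulr_sumr; apply: eq_bigr => -[j /= jlen] _; rewrite ltnS in jlen.
have [oN|eN] := boolP (odd (n - i - j)).
  by rewrite Tterm_odd // phi21conv_odd // !mulr0.
have [h hE] : exists h, (n - i - j)%N = h.*2.
  by exists (n - i - j)./2; rewrite -[LHS]odd_double_half (negPf eN).
have nE : (n - i)%N = (j + h.*2)%N by rewrite -hE subnKC.
have nE2 : n = (i + (j + h.*2))%N by rewrite -nE subnKC.
have esgn : (-1) ^+ (n - i) = (-1) ^+ j :> F.
  by rewrite nE exprD -[(-1) ^+ h.*2]signr_odd odd_double mulr1.
have tj := @inner_factor F q q0 b c m j h b0 c0; cbv zeta in tj; rewrite -nE in tj.
have {}tj := tj qN Hb2 Hc2 Hcb2.
rewrite hE esgn.
have ti := @outer_factor F q q0 A c C l i (n - i) A0; cbv zeta in ti; rewrite subnKC // in ti.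
have {}ti := ti qn HA2 HAc HC HAC.
have ts := @Tterm_split A c l m i j h A0 c0 two; cbv zeta in ts; rewrite -nE subnKC // in ts.
rewrite ts /qpochs !big_cons !big_nil !mulr1 outer_prefactor //.
rewrite -/b -/C in ti tj *.
transitivity (qpoch q q n * qpoch q (- (A * C)) n / (qpoch q A n * qpoch q C n)
    * expand_coef (A * q ^+ l) A c C n i *
   ((-1) ^+ j * expand_coef C c b b (n - i) j
    * phi21conv (c * q ^+ j) b (c * q ^+ j) b h.*2)); last by rewrite !mulrA.
have regroup (p x y z t k w : F) : p * x = k * w ->
    p * (x * y * z * t) = k * (w * y * z * t).
  by move=> e; rewrite !mulrA e.
by rewrite -tj; apply: regroup.
Qed.

End GenericIdentity.

(** * Values at 1 of rational functions *)

Section Specialization.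
Variables (F K : fieldType) (iota : {rmorphism {poly F} -> K}).
Hypothesis iota_inj : injective iota.
Implicit Types (x : K) (y : F).

(* y is the value at X = 1 of the rational function x, which is regular there. *)
Definition specializes x y := exists P Q : {poly F},
  [/\ Q.[1] != 0, x = iota P / iota Q & y = P.[1] / Q.[1]].

Definition constK (y : F) : K := iota y%:P.
Definition varK : K := iota 'X.

Lemma iota_eq0 (P : {poly F}) : (iota P == 0) = (P == 0).
Proof. by rewrite -(inj_eq iota_inj) rmorph0. Qed.

Lemma iota_neq0 (Q : {poly F}) : Q.[1] != 0 -> iota Q != 0.
Proof.
by move=> nQ; rewrite iota_eq0; apply: contraNneq nQ => ->; rewrite horner0.
Qed.

Lemma spec_poly (P : {poly F}) : specializes (iota P) P.[1].
Proof. by exists P, 1; rewrite hornerC oner_neq0 rmorph1 !divr1. Qed.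

Lemma spec_const y : specializes (constK y) y.
Proof. by have := spec_poly y%:P; rewrite hornerC. Qed.

Lemma spec_var : specializes varK 1.
Proof. by have := spec_poly 'X; rewrite hornerX. Qed.

Lemma spec0 : specializes 0 0.
Proof. by have := spec_poly 0; rewrite horner0 rmorph0. Qed.

Lemma spec1 : specializes 1 1.
Proof. by have := spec_poly 1; rewrite hornerC rmorph1. Qed.

Lemma specD x1 x2 y1 y2 : specializes x1 y1 -> specializes x2 y2 ->
  specializes (x1 + x2) (y1 + y2).
Proof.
move=> [P1 [Q1 [n1 -> ->]]] [P2 [Q2 [n2 -> ->]]].
exists (P1 * Q2 + P2 * Q1), (Q1 * Q2).
have m1 := iota_neq0 n1; have m2 := iota_neq0 n2.
rewrite hornerD !hornerM rmorphD !rmorphM; split; first exact: mulf_neq0.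
  by rewrite addf_div.
by rewrite addf_div.
Qed.

Lemma specM x1 x2 y1 y2 : specializes x1 y1 -> specializes x2 y2 ->
  specializes (x1 * x2) (y1 * y2).
Proof.
move=> [P1 [Q1 [n1 -> ->]]] [P2 [Q2 [n2 -> ->]]].
exists (P1 * P2), (Q1 * Q2).
rewrite !hornerM !rmorphM; split; first exact: mulf_neq0.
  by rewrite invfM mulrACA.
by rewrite invfM mulrACA.
Qed.

Lemma specN x y : specializes x y -> specializes (- x) (- y).
Proof.
move=> [P [Q [n -> ->]]]; exists (- P), Q.
by rewrite hornerN rmorphN !mulNr.
Qed.

Lemma specV x y : specializes x y -> y != 0 -> specializes x^-1 y^-1.
Proof.
move=> [P [Q [n -> ->]]]; rewrite mulf_eq0 negb_or => /andP[nP _].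
by exists Q, P; rewrite !invf_div.
Qed.

(** Injectivity of [iota] turns equality of the two fractions into the polynomial identity P1 Q2 =
    P2 Q1, which can be evaluated at 1. Identities over K descend to F in this way. *)
Lemma specializes_inj x y1 y2 : specializes x y1 -> specializes x y2 -> y1 = y2.
Proof.
move=> [P1 [Q1 [n1 -> ->]]] [P2 [Q2 [n2 /eqP E ->]]].
apply/eqP; rewrite eqr_div // -!hornerM.
move: E; rewrite eqr_div ?iota_neq0 // -!rmorphM (inj_eq iota_inj) => /eqP ->.
by [].
Qed.

Lemma specX x y n : specializes x y -> specializes (x ^+ n) (y ^+ n).
Proof.
move=> Hx; elim: n => [|n IHn]; first exact: spec1.
by rewrite !exprS; apply: specM.
Qed.

Lemma specXz x y (z : int) : specializes x y -> y != 0 ->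
  specializes (x ^ z) (y ^ z).
Proof.
move=> Hx y0; case: z => n; first exact: specX.
by rewrite !NegzE -!invr_expz; apply: specV; rewrite ?expf_neq0 //; apply: specX.
Qed.

Lemma spec_sum I (r : seq I) (f : I -> K) (g : I -> F) :
  (forall i, specializes (f i) (g i)) ->
  specializes (\sum_(i <- r) f i) (\sum_(i <- r) g i).
Proof.
move=> H; elim: r => [|i r IHr]; first by rewrite !big_nil; apply: spec0.
by rewrite !big_cons; apply: specD.
Qed.

Lemma spec_qpoch qK q x y n : specializes qK q -> specializes x y ->
  specializes (qpoch qK x n) (qpoch q y n).
Proof.
move=> Hq Hx; elim: n => [|n IHn]; first by rewrite !qpoch0; apply: spec1.
rewrite !qpochS; apply: specM => //; apply: specD; first exact: spec1.
by apply: specN; apply: specM => //; apply: specX.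
Qed.

Fixpoint seq_specializes (xs : seq K) (ys : seq F) : Prop :=
  match xs, ys with
  | [::], [::] => True
  | x :: xs', y :: ys' => specializes x y /\ seq_specializes xs' ys'
  | _, _ => False
  end.

Lemma spec_qpochs qK q xs ys n : specializes qK q -> seq_specializes xs ys ->
  specializes (qpochs qK xs n) (qpochs q ys n).
Proof.
move=> Hq; rewrite /qpochs.
elim: xs ys => [|x xs IHxs] [|y ys] //=; first by rewrite !big_nil; move=> _; apply: spec1.
by case=> Hx Hxs; rewrite !big_cons; apply: specM; [apply: spec_qpoch | apply: IHxs].
Qed.

Lemma constK_qpoch q y n : constK (qpoch q y n) = qpoch (constK q) (constK y) n.
Proof.
rewrite /qpoch /constK !rmorph_prod; apply: eq_bigr => i _.
by rewrite !(rmorphB, rmorphM, rmorphXn, rmorph1).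
Qed.

Lemma constK_eq0 y : (constK y == 0) = (y == 0).
Proof. by rewrite iota_eq0 polyC_eq0. Qed.

(** A relation y q^k X^(d+1) = 1 would be an identity of polynomials in X, refuted at X = 0. Roots
    of unity q are therefore no obstacle. *)
Lemma nonqpow_varK q y d : nonqpow (constK q) (constK y * varK ^+ d.+1).
Proof.
move=> k; have -> : constK q ^ k = constK (q ^ k).
  rewrite /constK; case: k => k; first by rewrite -!exprnP polyC_exp rmorphXn.
  rewrite !NegzE -!invr_expz -!exprnP -rmorphXn -polyC_exp.
  have [->|n0] := eqVneq (q ^+ k.+1) 0; first by rewrite invr0 polyC0 rmorph0 invr0.
  apply: (mulfI (x := iota (q ^+ k.+1)%:P)); first by rewrite iota_eq0 polyC_eq0.
  rewrite mulfV ?iota_eq0 ?polyC_eq0 // -rmorphM -polyCM mulfV //.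
  by rewrite polyC1 rmorph1.
have -> : constK y * varK ^+ d.+1 * constK (q ^ k)
    = iota ((y * q ^ k)%:P * 'X^(d.+1)).
  by rewrite /constK /varK polyCM !rmorphM rmorphXn mulrAC.
rewrite -[X in _ != X](rmorph1 iota) (inj_eq iota_inj).
apply/eqP => /(congr1 (fun P => P.[0])); rewrite hornerM hornerXn hornerC.
by rewrite expr0n mulr0 hornerC => /esym/eqP; rewrite oner_eq0.
Qed.

End Specialization.

(** Follows the syntax of an expression; each inverse leaves the goal that its denominator is
    nonzero at the specialized parameters, to be met by a definedness hypothesis. *)
Ltac spec_step :=
  match goal with
  | |- specializes _ (_ + _) (_ + _) => apply: specD
  | |- specializes _ (_ * _) (_ * _) => apply: specM
  | |- specializes _ (- _) (- _) => apply: specN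
  | |- specializes _ (_ ^+ _) (_ ^+ _) => apply: specX
  | |- specializes _ (_ ^ _) (_ ^ _) => apply: specXz
  | |- specializes _ (_^-1) (_^-1) => apply: specV
  | |- specializes _ (qpoch _ _ _) (qpoch _ _ _) => apply: spec_qpoch
  | |- specializes _ (qpochs _ _ _) (qpochs _ _ _) => apply: spec_qpochs
  | |- specializes _ 1 1 => exact: spec1
  | |- specializes _ 0 0 => exact: spec0
  | |- seq_specializes _ _ _ => rewrite /=; do ?split
  | |- _ => assumption
  end.

(** * Descent from t a, t c to a, c *)

Section SpecializedIdentity.
Variables (F K : fieldType) (iota : {rmorphism {poly F} -> K}).
Hypothesis iota_inj : injective iota.
Local Notation spec := (specializes iota).

(** Where T is read as 0, it is 0 both over K and over F; definedness is thus asked for only at the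
    remaining indices. *)
Lemma spec_Tterm qK aK cK q a c l m n i j :
  spec qK q -> spec aK a -> spec cK c -> q != 0 -> a != 0 -> c != 0 ->
  (2%:R != 0 :> F) ->
  ((i + j <= n)%N -> ~~ odd (n - i - j) -> Tterm_defined q a c l m n i j) ->
  spec (Tterm qK aK cK l m n i j) (Tterm q a c l m n i j).
Proof.
move=> Hq Ha Hc q0 a0 c0 two Hdef.
have [ij|] := boolP (i + j <= n)%N; last first.
  by rewrite -ltnNge => ij; rewrite !Tterm_gt //; apply: spec0.
have [o|e] := boolP (odd (n - i - j)).
  by rewrite !Tterm_odd //; apply: spec0.
have [d1 d2 d3 d4] := Hdef ij e.
rewrite /Tterm ij /chi.
have a20 : a ^+ 2 != 0 by rewrite expf_neq0.
have ac0 : a ^+ 2 * c ^+ 2 != 0 by rewrite mulf_neq0 // expf_neq0.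
repeat spec_step => //.
by rewrite -[2%:R]/(1 + 1) -[2%:R]/(1 + 1); apply: specD => //; apply: spec1.
Qed.

Theorem double_sum_specialized (q a c : F) (l m n : nat) : (2%:R != 0 :> F) ->
  q != 0 -> a != 0 -> c != 0 ->
  (forall k : nat, (k <= n)%N ->
     qpochs q [:: q; q ^ (1 + l%:Z - n%:Z) / a;
                  q ^ (1 - m%:Z - n%:Z) / c; - (a * c)] k != 0) ->
  qpochs q [:: q ^ (1 + l%:Z) / a ^+ 2; - q ^ (1 - n%:Z) / a] l != 0 ->
  qpochs q [:: - (a * c); q ^ m%:Z * c] n != 0 ->
  (forall i j : nat, (i <= l)%N -> (j <= m)%N ->
     (i + j <= n)%N -> ~~ odd (n - i - j) -> Tterm_defined q a c l m n i j) ->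
  phi43 q n a c (- q ^ (1 + l%:Z - m%:Z - n%:Z) / (a * c))
    (q ^ (1 + l%:Z - n%:Z) / a) (q ^ (1 - m%:Z - n%:Z) / c) (- (a * c)) q
  = qpochs q [:: q ^ (1 + l%:Z - n%:Z) / a ^+ 2; - q / a] l
      / qpochs q [:: q ^ (1 + l%:Z) / a ^+ 2; - q ^ (1 - n%:Z) / a] l
    * (qpochs q [:: - a; q ^ m%:Z * c ^+ 2] n
      / qpochs q [:: - (a * c); q ^ m%:Z * c] n)
    * \sum_(0 <= i < l.+1) \sum_(0 <= j < m.+1) Tterm q a c l m n i j.
Proof.
move=> two q0 a0 c0 dphi dl dn dT.
pose qK := constK iota q.
pose aK := constK iota a * varK iota; pose cK := constK iota c * varK iota.
have Hq : spec qK q by apply: spec_const.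
have Ha : spec aK a by rewrite -[a]mulr1; apply: specM; [apply: spec_const | apply: spec_var].
have Hc : spec cK c by rewrite -[c]mulr1; apply: specM; [apply: spec_const | apply: spec_var].
have qK0 : qK != 0 by rewrite constK_eq0.
have varK0 : varK iota != 0 by rewrite iota_eq0 // polyX_eq0.
have aK0 : aK != 0 by rewrite mulf_neq0 // constK_eq0.
have cK0 : cK != 0 by rewrite mulf_neq0 // constK_eq0.
have twoK : 2%:R != 0 :> K.
  by rewrite -(rmorph_nat iota) iota_eq0 // -polyC_natr polyC_eq0.
have qnK : qpoch qK qK n != 0.
  rewrite -constK_qpoch constK_eq0 //; move: (dphi n (leqnn n)).
  by rewrite /qpochs !big_cons mulf_eq0 negb_or => /andP[].
have constX y d : constK iota y ^+ d = constK iota (y ^+ d).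
  by rewrite /constK polyC_exp rmorphXn.
have Ha2 : nonqpow qK (aK ^+ 2).
  by rewrite /aK exprMn constX; apply: nonqpow_varK.
have Hc2 : nonqpow qK (cK ^+ 2).
  by rewrite /cK exprMn constX; apply: nonqpow_varK.
have Hac2 : nonqpow qK ((aK * cK) ^+ 2).
  rewrite exprMn /aK /cK !exprMn !constX mulrACA -exprD /constK -rmorphM -polyCM.
  exact: nonqpow_varK.
have E := double_sum_generic qK0 l m aK0 cK0 twoK qnK Ha2 Hc2 Hac2.
have ac0 : a * c != 0 by rewrite mulf_neq0.
have a20 : a ^+ 2 != 0 by rewrite expf_neq0.
(* The deformed series specializes to the series at a, c; rewritten by [E], the same element of K
   specializes to the double sum. *)
apply: (@specializes_inj _ _ _ iota_inj (phi43 qK n aK cK (- qK ^ (1 + l%:Z - m%:Z - n%:Z) / (aK * cK))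
    (qK ^ (1 + l%:Z - n%:Z) / aK) (qK ^ (1 - m%:Z - n%:Z) / cK) (- (aK * cK)) qK)).
  rewrite /phi43 !big_mkord.
  apply: spec_sum => // k.
  have dk : _ := dphi k (ltn_ord k).
  by repeat spec_step => //.
rewrite E.
apply: specM => //; last first.
  rewrite !big_mkord; apply: spec_sum => // i; rewrite !big_mkord.
  apply: spec_sum => // j; apply: spec_Tterm => //.
  by apply: dT; rewrite -ltnS.
by repeat spec_step => //.
Qed.
End SpecializedIdentity.

Unset Implicit Arguments.
Local Open Scope complex_scope.

Theorem mainTheorem5 (R : realType) (q a c : R[i]) (l m n : nat)
  (q_neq0 : q != 0) (a_neq0 : a != 0) (c_neq0 : c != 0)
  (phi_defined : forall k : nat, (k <= n)%N ->
     qpochs q [:: q; q ^ (1 + l%:Z - n%:Z) / a;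
                  q ^ (1 - m%:Z - n%:Z) / c; - (a * c)] k != 0)
  (prefactor_l_defined :
     qpochs q [:: q ^ (1 + l%:Z) / a ^+ 2; - q ^ (1 - n%:Z) / a] l != 0)
  (prefactor_n_defined :
     qpochs q [:: - (a * c); q ^ m%:Z * c] n != 0)
  (T_defined : forall i j : nat, (i <= l)%N -> (j <= m)%N ->
     (i + j <= n)%N -> ~~ odd (n - i - j) -> Tterm_defined q a c l m n i j) :
  phi43 q n a c (- q ^ (1 + l%:Z - m%:Z - n%:Z) / (a * c))
    (q ^ (1 + l%:Z - n%:Z) / a) (q ^ (1 - m%:Z - n%:Z) / c) (- (a * c)) q
  = qpochs q [:: q ^ (1 + l%:Z - n%:Z) / a ^+ 2; - q / a] l
      / qpochs q [:: q ^ (1 + l%:Z) / a ^+ 2; - q ^ (1 - n%:Z) / a] l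
    * (qpochs q [:: - a; q ^ m%:Z * c ^+ 2] n
      / qpochs q [:: - (a * c); q ^ m%:Z * c] n)
    * \sum_(0 <= i < l.+1) \sum_(0 <= j < m.+1) Tterm q a c l m n i j.
Proof.
apply: (@double_sum_specialized _ {fraction {poly R[i]}} (@tofrac _)) => //.
  by move=> x y /eqP; rewrite tofrac_eq => /eqP.
by rewrite Num.Theory.pnatr_eq0.
Qed.
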